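(* Let $M$ be a countable locally finite structure such that algebraic closures of finite subsets of $M$ are finite, and let $G=\mathrm{Aut}(M)$. Suppose that for some $n\geq 1$, $G$ has a dense $n$-diagonal conjugacy class. Then, for every $n$-tuple $\bar f$ in $L_0(G)$, at least one of the following holds: \begin{itemize} \item $\langle\bar f\rangle$ is precompact, or \item $\langle\bar f\rangle$ is discrete, or \item the topological $n$-similarity class of $\bar f$ is meager in $L_0(G)^n$. \end{itemize}
   Context: A structure is a set with relations and functions; it is locally finite if all its finitely generated substructures are finite. $\mathrm{Aut}(M)$ carries the pointwise convergence topology ($M$ discrete), making it a Polish group. For finite $A\subseteq M$, $\mathrm{Aut}_A(M)$ is the pointwise stabilizer of $A$ in $\mathrm{Aut}(M)$, and the algebraic closure of $A$ is the set of all elements of $M$ whose orbit under the evaluation action of $\mathrm{Aut}_A(M)$ is finite. Let $\mu$ be the Lebesgue measure on $[0,1]$. For a Polish group $G$, $L_0(G)$ is the Polish group of all $\mu$-equivalence classes of $\mu$-measurable functions $[0,1]\to G$, with pointwise multiplication and the topology of convergence in measure: a basic neighbourhood of the identity is $\{f\in L_0(G)\colon \mu(\{x\colon f(x)\notin V\})<\epsilon\}$, where $V$ is a neighbourhood of the identity in $G$ and $\epsilon>0$. An $n$-diagonal conjugacy class of a group $H$ is an orbit of the action $g.(h_1,\ldots,h_n)=(gh_1g^{-1},\ldots,gh_ng^{-1})$ of $H$ on $H^n$. For an $n$-tuple $\bar f=(f_1,\ldots,f_n)$ in a topological group $H$, $\langle\bar f\rangle$ is the subgroup generated by $\{f_1,\ldots,f_n\}$.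 A subgroup is precompact if its closure in $H$ is compact, and discrete if its subspace topology is discrete. The topological $n$-similarity class of $\bar f$ is the set of all $\bar g=(g_1,\ldots,g_n)\in H^n$ such that the map $f_i\mapsto g_i$ extends (necessarily uniquely) to a bi-continuous group isomorphism between $\langle\bar f\rangle$ and $\langle\bar g\rangle$, taken with the subspace topologies. *)

(* Defs.v *)
From HB Require Import structures.
From mathcomp Require Import all_boot all_order all_algebra.
From mathcomp Require Import all_classical all_reals all_analysis.

Set Implicit Arguments.
Unset Strict Implicit.
Unset Printing Implicit Defensive.

Import Order.TTheory GRing.Theory Num.Theory.
Import numFieldNormedType.Exports.

Local Open Scope classical_set_scope.

(* The base point plays no role beyond the fact that the library only equips
   pointed types with sigma-algebras; the instances below use 1. *)
#[short(type="preTopologicalGroupType")]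
HB.structure Definition PreTopologicalGroup := {G of PointedTopological G & Group G}.

HB.mixin Record isTopologicalGroup G & PreTopologicalGroup G := {
  mulg_continuous : continuous (fun x : G * G => (x.1 * x.2)%g) ;
  invg_continuous : continuous (fun x : G => x^-1%g) }.

#[short(type="topologicalGroupType")]
HB.structure Definition TopologicalGroup :=
  {G of PreTopologicalGroup G & isTopologicalGroup G}.

HB.mixin Record isSecondCountable T & Topological T := {
  second_countableP : @second_countable T }.

(* Every Polish group is one. Second countability is what makes the pointwise
   product of two Borel-measurable functions Borel-measurable. *)
#[short(type="secondCountableGroupType")]
HB.structure Definition SecondCountableGroup :=
  {G of TopologicalGroup G & isSecondCountable G}.

Section topological_groups.
Context (H : topologicalGroupType) (n : nat).
Implicit Types (f g : 'I_n -> H) (A B : set H).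

Definition diagonal_conj_class f : set {ptws 'I_n -> H} :=
  [set (fun i => k * f i * k^-1)%g | k in [set: H]].

Definition is_subgroup A : Prop :=
  [/\ A 1%g, (forall x y, A x -> A y -> A (x * y)%g) &
      (forall x, A x -> A x^-1%g)].

Definition generated_subgroup f : set H := smallest is_subgroup (range f).

Definition precompact_set A : Prop := compact (closure A).

(* [x] ranges over the subtype attached to [A], with the subspace topology. *)
Definition discrete_set A : Prop := forall x : A, open [set x].

Definition bicontinuous_isomorphism A B (phi : H -> H) : Prop :=
  [/\ set_bij A B phi,
      {in A &, {morph phi : x y / (x * y)%g}},
      {within A, continuous phi} &
      exists2 psi : H -> H, {in A, cancel phi psi} & {within B, continuous psi}].

Definition topological_similarity_class f : set {ptws 'I_n -> H} :=
  [set g : {ptws 'I_n -> H} | exists2 phi,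
    bicontinuous_isomorphism (generated_subgroup f) (generated_subgroup g) phi &
    forall i, phi (f i) = g i].

End topological_groups.

Definition nowhere_dense (T : topologicalType) (A : set T) : Prop :=
  (closure A)° = set0.

Definition meager (T : topologicalType) (A : set T) : Prop :=
  exists2 F : (set T)^nat, (forall k, nowhere_dense (F k)) &
    A `<=` \bigcup_k F k.

Section structures.

Record language := Language {
  rel_symbol : Type;
  rel_arity : rel_symbol -> nat;
  fun_symbol : Type;
  fun_arity : fun_symbol -> nat }.

Record structure (L : language) (M : Type) := Structure {
  rel_interp : forall r : rel_symbol L, set ('I_(rel_arity r) -> M);
  fun_interp : forall s : fun_symbol L, ('I_(fun_arity s) -> M) -> M }.

Context (L : language) (M : countType) (S : structure L M).

Definition is_substructure (A : set M) : Prop :=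
  forall s (t : 'I_(fun_arity s) -> M), (forall i, A (t i)) -> A (fun_interp S t).

Definition locally_finite : Prop :=
  forall A : set M, finite_set A -> finite_set (smallest is_substructure A).

Record aut := Aut {
  aut_fun :> M -> M;
  aut_bij : bijective aut_fun;
  aut_rel : forall r (t : 'I_(rel_arity r) -> M),
    rel_interp S (aut_fun \o t) <-> rel_interp S t;
  aut_interp : forall s (t : 'I_(fun_arity s) -> M),
    fun_interp S (aut_fun \o t) = aut_fun (fun_interp S t) }.

Definition pointwise_stabilizer (A : set M) : set aut :=
  [set g | forall a, A a -> g a = a].

Definition acl (A : set M) : set M :=
  [set b | finite_set [set (g : aut) b | g in pointwise_stabilizer A]].

HB.instance Definition _ := gen_eqMixin aut.
HB.instance Definition _ := gen_choiceMixin aut.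

Lemma aut_inj (g h : aut) : aut_fun g = aut_fun h -> g = h.
Proof.
case: g h => [g b1 r1 i1] [h b2 r2 i2] /= gh; subst h.
by congr Aut; exact: Prop_irrelevance.
Qed.

#[local] Obligation Tactic := idtac.

Program Definition aut1 : aut := @Aut id _ _ _.
Next Obligation. by exists id. Qed.
Next Obligation. by []. Qed.
Next Obligation. by []. Qed.

Program Definition autM (g h : aut) : aut := @Aut (g \o h) _ _ _.
Next Obligation. by move=> g h; apply: bij_comp; exact: aut_bij. Qed.
Next Obligation. by move=> g h r t; rewrite compA !aut_rel. Qed.
Next Obligation. by move=> g h s t; rewrite -compA !aut_interp. Qed.

Lemma aut_surj (g : aut) (x : M) : exists y, g y = x.
Proof. by have [h _ hK] := aut_bij g; exists (h x). Qed.

Definition aut_inv_fun (g : aut) (x : M) : M := projT1 (cid (aut_surj g x)).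

Lemma aut_inv_funK (g : aut) : cancel (aut_inv_fun g) g.
Proof. by move=> x; rewrite /aut_inv_fun; case: cid. Qed.

Lemma aut_funK (g : aut) : cancel g (aut_inv_fun g).
Proof. by move=> x; apply: (bij_inj (aut_bij g)); rewrite aut_inv_funK. Qed.

Program Definition autV (g : aut) : aut := @Aut (aut_inv_fun g) _ _ _.
Next Obligation. by move=> g; exists g; [exact: aut_inv_funK|exact: aut_funK]. Qed.
Next Obligation.
move=> g r t; have {2}-> : t = g \o (aut_inv_fun g \o t).
  by apply/funext => i /=; rewrite aut_inv_funK.
by rewrite aut_rel.
Qed.
Next Obligation.
move=> g s t; apply: (bij_inj (aut_bij g)); rewrite aut_inv_funK -aut_interp.
by congr fun_interp; apply/funext => i /=; rewrite aut_inv_funK.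
Qed.

Lemma autMA : associative autM. Proof. by move=> *; exact: aut_inj. Qed.
Lemma aut1M : left_id aut1 autM. Proof. by move=> *; exact: aut_inj. Qed.
Lemma autM1 : right_id aut1 autM. Proof. by move=> *; exact: aut_inj. Qed.
Lemma autVM : left_inverse aut1 autV autM.
Proof. by move=> g; apply/aut_inj/funext => x /=; exact: aut_funK. Qed.
Lemma autMV : right_inverse aut1 autV autM.
Proof. by move=> g; apply/aut_inj/funext => x /=; exact: aut_inv_funK. Qed.

HB.instance Definition _ := isGroup.Build aut autMA aut1M autM1 autVM autMV.
HB.instance Definition _ := isPointed.Build aut 1%g.

(* Pointwise convergence, M being discrete: the topology induced by the
   product topology on M -> M. *)
Definition aut_ptws (g : aut) : {ptws M -> discrete_topology M} := aut_fun g.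

HB.instance Definition _ := Topological.copy aut (initial_topology aut_ptws).


Lemma aut_cvg (F : set_system aut) (g : aut) : Filter F ->
  (forall a, \forall h \near F, (h : aut) a = g a) -> F --> g.
Proof.
move=> FF Fg A /= [_ [ [U oU <-] Ug UA]].
have : (aut_ptws @ F) --> aut_ptws g.
  apply/cvg_sup => a W [_ [ [B oB <-] Bg BW]].
  by apply: filterS (Fg a) => h hg; apply: BW; rewrite /= /aut_ptws hg.
move=> /(_ U (open_nbhs_nbhs (conj oU Ug))) FU.
have {}FU : F (aut_ptws @^-1` U) by exact: FU.
exact: (filterS UA FU).
Qed.

Lemma near_aut (g : aut) a : \forall h \near g, (h : aut) a = g a.
Proof.
have cg : continuous (fun h : aut => (h a : discrete_topology M)).
  move=> h; apply: (@continuous_comp _ _ _ aut_ptws (@^~ a)).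
    exact: initial_continuous.
  exact: (@proj_continuous _ (fun=> discrete_topology M)).
exact: (cg g [set g a] (discrete_set1 _)).
Qed.

Lemma autM_continuous : continuous (fun x : aut * aut => (x.1 * x.2)%g).
Proof.
move=> [g h]; apply: aut_cvg => a /=.
exists ([set g' : aut | g' (h a) = g (h a)], [set h' : aut | h' a = h a]).
  by split; exact: near_aut.
by move=> [g' h'] /= [g'E h'E]; rewrite -g'E -h'E.
Qed.

Lemma autV_continuous : continuous (fun x : aut => x^-1%g).
Proof.
move=> g; apply: (@aut_cvg _ _ (fmap_filter _ (nbhs_filter g))) => a /=.
apply: filterS (near_aut g ((g^-1)%g a)) => h hE.
apply: (bij_inj (aut_bij h)); rewrite hE.
by rewrite [LHS]aut_inv_funK [RHS]aut_inv_funK.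
Qed.

HB.instance Definition _ :=
  isTopologicalGroup.Build aut autM_continuous autV_continuous.

Lemma aut_second_countable : @second_countable aut.
Proof.
pose U (p : seq M * seq M) := [set h : aut | map h p.1 = p.2].
have nU (h : aut) (s : seq M) : \forall h' \near h, map (h' : aut) s = map h s.
  elim: s => [|a s ihs]; first exact: filterE.
  by apply: filterS2 ihs (near_aut h a) => h' /= -> ->.
exists (range U); first exact: (sub_countable (card_image_le _ _) (countableP _)).
split=> [_ [ [s t] _ <-]|g].
  rewrite openE => h hs; apply: filterS (nU h s) => h' hh'; rewrite /U /= hh'.
  exact: hs.
apply: aut_cvg.
  apply: filter_from_filter; first by exists (U ([::], [::])); split=> //; exists ([::], [::]).
  move=> _ _ [ [ [s t] _ <-] /= sE] [ [ [s' t'] _ <-] /= s'E].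
  exists (U (s ++ s', t ++ t')).
    by split; [exists (s ++ s', t ++ t')|rewrite /U /= map_cat sE s'E].
  move=> h /= /eqP; rewrite map_cat eqseq_cat ?size_map; last first.
    by rewrite -[t]sE size_map.
  by move=> /andP[/eqP ? /eqP ?].
move=> a; exists (U ([:: a], [:: g a])); last by move=> h [].
by split=> //; exists ([:: a], [:: g a]).
Qed.

HB.instance Definition _ := isSecondCountable.Build aut aut_second_countable.

End structures.
Section second_countable_groups.
Context (G : secondCountableGroupType).

Definition borelType := g_sigma_algebraType (@open G).
HB.instance Definition _ := Measurable.on borelType.

Lemma countable_base : exists B : (set G)^nat, (forall n, open (B n)) /\
  forall (x : G) (U : set G), nbhs x U -> exists n, B n x /\ B n `<=` U.
Proof.
have [B cB [oB bB]] := @second_countableP G.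
have [B0|[f]] := pfcard_geP cB.
  have [U [BU _] _] := bB (1%g : G) setT filterT.
  by have : (set0 : set (set G)) U by rewrite -B0.
exists f; split=> [n|x U /bB [V [BV Vx] VU]].
  by apply: oB; apply: (@funS _ _ _ _ f).
by have [n _ fn] := (@surj _ _ _ _ f) V BV; exists n; rewrite fn.
Qed.

Lemma borel_open (U : set G) : open U -> measurable (U : set borelType).
Proof. exact: sub_sigma_algebra. Qed.

Context d (T : measurableType d).

Lemma borel_measurable (f : T -> borelType) :
  (forall U : set G, open U -> measurable (f @^-1` U)) -> measurable_fun setT f.
Proof.
move=> mf; apply: (@measurability _ _ T borelType setT f (@open G)) => // _ [U oU <-].
by rewrite setTI; exact: mf.
Qed.

Lemma measurable_mulg (f g : T -> borelType) :
  measurable_fun setT f -> measurable_fun setT g ->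
  measurable_fun setT (fun x => (f x : G) * (g x : G) : borelType)%g.
Proof.
move=> mf mg; apply: borel_measurable => U oU.
have [B [oB bB]] := countable_base.
rewrite (_ : _ @^-1` U = \bigcup_n \bigcup_(m in [set m |
    forall x y, B n x -> B m y -> U (x * y)%g]) (f @^-1` B n `&` g @^-1` B m)).
  apply: bigcup_measurable => n _; apply: bigcup_measurable => m _.
  apply: measurableI; rewrite -[_ @^-1` _]setTI.
    by apply: mf => //; exact: borel_open.
  by apply: mg => //; exact: borel_open.
apply/seteqP; split=> [x Ux|x [n _ [m /= + [fx gx]]]]; last exact.
have /(mulg_continuous (f x : G, g x : G)) : nbhs ((f x : G) * (g x : G))%g U.
  exact: open_nbhs_nbhs.
case=> -[V W] /= [/bB[n [fn nV]] /bB[m [gm mW]]] VWU.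
exists n => //; exists m => //= y z /nV Vy /mW Wz.
exact: (VWU (y, z)).
Qed.

Lemma measurable_invg (f : T -> borelType) :
  measurable_fun setT f -> measurable_fun setT (fun x => (f x : G)^-1 : borelType)%g.
Proof.
move=> mf; apply: borel_measurable => U oU.
rewrite (_ : _ @^-1` U = setT `&` f @^-1` ((fun x : G => x^-1)%g @^-1` U)).
  by apply: mf => //; apply: borel_open; apply: open_comp => // x _; exact: invg_continuous.
by rewrite setTI.
Qed.

End second_countable_groups.

Section L0.
Context (R : realType).

(* The real line with all Lebesgue-measurable sets. *)
Definition lebesgueType := caratheodory_type
  (mu_ext (wlength idfun : set (ocitv_type R) -> \bar R)).
HB.instance Definition _ := Measurable.on lebesgueType.

Lemma measurable_unit_itv : measurable (`[0%R, 1%R] : set lebesgueType).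
Proof. by apply: sub_caratheodory; exact: measurable_itv. Qed.

(* Lebesgue measure on [0, 1], carried by the real line: the complement of
   [0, 1] is null, so that two functions agreeing a.e. on [0, 1] are
   identified in L0. *)
Definition mu01 : set lebesgueType -> \bar R :=
  mrestr completed_lebesgue_measure measurable_unit_itv.
HB.instance Definition _ := Measure.on mu01.

Lemma mu01T : mu01 setT = 1%E.
Proof.
rewrite /mu01 /mrestr setTI.
have := @lebesgue_measure_itv R `[0%R, 1%R]%R; rewrite /= lte_fin ltr01 oppr0 adde0.
exact.
Qed.

Context (G : secondCountableGroupType).

Definition L0 : Type := {mfun_ mu01, lebesgueType >-> borelType G}.
HB.instance Definition _ := Choice.on L0.


Definition L0_fun (f : L0) : lebesgueType -> G := aqEqMfun_to_fun f.
Coercion L0_fun : L0 >-> Funclass.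

Lemma L0_measurable (f : L0) :
  measurable_fun setT (L0_fun f : lebesgueType -> borelType G).
Proof. exact: measurable_funPT. Qed.

Definition L0_class (u : {mfun lebesgueType >-> borelType G}) : L0 :=
  (\pi_({mfun_ mu01, lebesgueType >-> borelType G}) u)%qT.

Lemma L0_eq (f g : L0) : (\forall x \ae mu01, f x = g x) -> f = g.
Proof.
move=> fg; rewrite -[f]reprK -[g]reprK; apply/eqmodP/asboolP.
by apply: filterS fg.
Qed.

Lemma L0_classE u : \forall x \ae mu01, L0_class u x = u x.
Proof.
have /eqmodP/asboolP := reprK (L0_class u).
by apply: filterS => x /(_ I).
Qed.

Definition L0mul_mfun (f g : L0) : {mfun lebesgueType >-> borelType G} :=
  mfun_Sub (mem_set (measurable_mulg (L0_measurable f) (L0_measurable g))).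
Definition L0inv_mfun (f : L0) : {mfun lebesgueType >-> borelType G} :=
  mfun_Sub (mem_set (measurable_invg (L0_measurable f))).

Definition L0mul (f g : L0) : L0 := L0_class (L0mul_mfun f g).
Definition L0inv (f : L0) : L0 := L0_class (L0inv_mfun f).
Definition L0one : L0 := L0_class (cst (1%g : G)).

Lemma L0mulE f g : \forall x \ae mu01, L0mul f g x = (f x * g x)%g.
Proof. exact: L0_classE. Qed.

Lemma L0invE f : \forall x \ae mu01, L0inv f x = (f x)^-1%g.
Proof. exact: L0_classE. Qed.

Lemma L0oneE : \forall x \ae mu01, L0one x = 1%g.
Proof. exact: L0_classE. Qed.

Lemma L0mulA : associative L0mul.
Proof.
move=> f g h; apply: L0_eq; near=> x.
rewrite (near (L0mulE f (L0mul g h)) x) ?(near (L0mulE g h) x)//.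
rewrite (near (L0mulE (L0mul f g) h) x) ?(near (L0mulE f g) x)//.
exact: mulgA.
Unshelve. all: by end_near. Qed.

Lemma L0mul1 : left_id L0one L0mul.
Proof.
move=> f; apply: L0_eq; near=> x.
by rewrite (near (L0mulE L0one f) x) ?(near L0oneE x)// mul1g.
Unshelve. all: by end_near. Qed.

Lemma L01mul : right_id L0one L0mul.
Proof.
move=> f; apply: L0_eq; near=> x.
by rewrite (near (L0mulE f L0one) x) ?(near L0oneE x)// mulg1.
Unshelve. all: by end_near. Qed.

Lemma L0mulV : left_inverse L0one L0inv L0mul.
Proof.
move=> f; apply: L0_eq; near=> x.
rewrite (near (L0mulE (L0inv f) f) x) ?(near (L0invE f) x)//.
by rewrite (near L0oneE x)// mulVg.
Unshelve. all: by end_near. Qed.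

Lemma L0Vmul : right_inverse L0one L0inv L0mul.
Proof.
move=> f; apply: L0_eq; near=> x.
rewrite (near (L0mulE f (L0inv f)) x) ?(near (L0invE f) x)//.
by rewrite (near L0oneE x)// mulgV.
Unshelve. all: by end_near. Qed.

HB.instance Definition _ := isGroup.Build L0 L0mulA L0mul1 L01mul L0mulV L0Vmul.
HB.instance Definition _ := isPointed.Build L0 1%g.

Lemma L0_mulE (f g : L0) : \forall x \ae mu01, L0_fun (f * g)%g x = (f x * g x)%g.
Proof. exact: L0mulE. Qed.

Lemma L0_invE (f : L0) : \forall x \ae mu01, L0_fun (f^-1)%g x = (f x)^-1%g.
Proof. exact: L0invE. Qed.

Lemma L0_oneE : \forall x \ae mu01, L0_fun 1%g x = 1%g.
Proof. exact: L0oneE. Qed.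

(* Basic neighbourhoods of 1 for convergence in measure, Ve.1 being an open
   neighbourhood of 1 in G and Ve.2 > 0; those of f are the left translates. *)
Definition L0ball (Ve : set G * R) : set L0 :=
  [set f | (mu01 [set x | ~ Ve.1 (f x)] < Ve.2%:E)%E].

Definition L0nbhs (f : L0) : set_system L0 :=
  filter_from [set Ve : set G * R | open_nbhs 1%g Ve.1 /\ (0 < Ve.2)%R]
    (fun Ve => [set g | L0ball Ve (f^-1 * g)%g]).

HB.instance Definition _ := hasNbhs.Build L0 L0nbhs.

Lemma measurable_L0bad (V : set G) (f : L0) : open V ->
  measurable [set x | ~ V (f x)].
Proof.
move=> oV; rewrite -[X in measurable X]/(~` (L0_fun f @^-1` V)).
apply: measurableC; rewrite -[_ @^-1` _]setTI.
by apply: L0_measurable => //; exact: borel_open.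
Qed.

Lemma ae_le_mu01 (A B : set lebesgueType) : measurable A -> measurable B ->
  (\forall x \ae mu01, A x -> B x) -> (mu01 A <= mu01 B)%E.
Proof.
move=> mA mB [N [mN N0 AB]].
apply: (@le_trans _ _ (mu01 (B `|` N))).
  apply: le_measure; rewrite ?inE//; first exact: measurableU.
  move=> x Ax; have [Bx|nBx] := pselect (B x); [by left|right].
  by apply: AB => /= /(_ Ax).
apply: (le_trans (measureU2 _ mB mN)).
by rewrite [X in (_ + X)%E](N0 : _ = 0%E) adde0.
Qed.

Lemma L0ball_mul (U V W : set G) (e1 e2 : R) (f g : L0) :
  open U -> open V -> open W -> (forall x y, V x -> W y -> U (x * y)%g) ->
  L0ball (V, e1) f -> L0ball (W, e2) g -> L0ball (U, e1 + e2)%R (f * g)%g.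
Proof.
move=> oU oV oW VWU fV gW; rewrite /L0ball /= EFinD.
apply: le_lt_trans (lteD fV gW).
apply: le_trans (measureU2 _ _ _); last 2 first.
  1,2: exact: measurable_L0bad.
apply: ae_le_mu01; [exact: measurable_L0bad|apply: measurableU; exact: measurable_L0bad|].
apply: filterS (L0_mulE f g) => x fgE /=; rewrite fgE.
move=> nU; apply: contrapT => /not_orP[/= /contrapT Vf /contrapT Wg].
exact/nU/VWU.
Qed.

Lemma L0ball_inv (V : set G) (e : R) (f : L0) : open V ->
  L0ball ((fun x => x^-1)%g @^-1` V, e) f -> L0ball (V, e) f^-1%g.
Proof.
move=> oV; apply: le_lt_trans; apply: ae_le_mu01.
- exact: measurable_L0bad.
- by apply: measurable_L0bad; apply: open_comp => // x _; exact: invg_continuous.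
by apply: filterS (L0_invE f) => x fE /=; rewrite fE.
Qed.

Lemma L0ball1 (V : set G) (e : R) : open_nbhs 1%g V -> (0 < e)%R ->
  L0ball (V, e) 1%g.
Proof.
move=> [oV V1] e0; rewrite /L0ball /=.
apply: (@le_lt_trans _ _ (mu01 set0)); last by rewrite measure0 lte_fin.
apply: ae_le_mu01 => //; first exact: measurable_L0bad.
by apply: filterS L0_oneE => x /= -> /(_ V1).
Qed.

Lemma L0ballS (V W : set G) (e1 e2 : R) : open V -> open W -> V `<=` W ->
  (e1 <= e2)%R -> L0ball (V, e1) `<=` L0ball (W, e2).
Proof.
move=> oV oW VW e12 f fV; apply: le_lt_trans (lt_le_trans fV _).
  apply: le_measure; rewrite ?inE; [exact: measurable_L0bad|exact: measurable_L0bad|].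
  by move=> x /= nW /VW.
by rewrite lee_fin.
Qed.

Lemma mulg_open1 (V : set G) : open_nbhs 1%g V ->
  exists2 W, open_nbhs 1%g W & forall x y, W x -> W y -> V (x * y)%g.
Proof.
move=> [oV V1].
have /(mulg_continuous (1%g : G, 1%g : G)) : nbhs ((1 : G) * (1 : G))%g V.
  by apply: open_nbhs_nbhs; split=> //; rewrite mulg1.
case=> -[A B] /= [nA nB] ABV; exists (A° `&` B°).
  by split; [apply: openI; exact: open_interior|split; exact: nbhs_singleton (nbhs_interior _)].
by move=> x y [/interior_subset Ax _] [_ /interior_subset By]; exact: (ABV (x, y)).
Qed.

Lemma L0nbhs_filter (f : L0) : ProperFilter (nbhs f).
Proof.
apply: filter_from_proper; last first.
  move=> [V e] /= [V1 e0]; exists f; rewrite /= mulVg; exact: L0ball1.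
apply: filter_from_filter.
  by exists (setT, 1%R); split=> //=; split => //; exact: openT.
move=> [V e] [W e'] /= [[oV V1] e0] [[oW W1] e'0].
exists (V `&` W, Num.min e e').
  by split=> /=; [split; [exact: openI|split]|rewrite lt_min e0].
move=> g /= gVW; split; apply: L0ballS gVW => //; do ?exact: openI.
- by rewrite ge_min lexx.
- by rewrite ge_min lexx orbT.
Qed.

Lemma L0nbhs_singleton (f : L0) (A : set L0) : nbhs f A -> A f.
Proof.
by move=> [[V e] /= [V1 e0]]; apply; rewrite /= mulVg; exact: L0ball1.
Qed.

Lemma L0nbhs_nbhs (f : L0) (A : set L0) : nbhs f A -> nbhs f (nbhs^~ A).
Proof.
move=> [[V e] /= [V1 e0] VA]; have [W W1 WV] := mulg_open1 V1.
exists (W, e / 2)%R => /=; first by rewrite divr_gt0.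
move=> g /= gW; exists (W, e / 2)%R => /=; first by rewrite divr_gt0.
move=> h /= hW; apply: VA => /=.
have -> : (f^-1 * h = (f^-1 * g) * (g^-1 * h))%g by rewrite mulgA mulgK.
rewrite [e]splitr; apply: L0ball_mul gW hW => //.
- by case: V1.
- by case: W1.
- by case: W1.
Qed.

HB.instance Definition _ :=
  Nbhs_isNbhsTopological.Build L0 L0nbhs_filter L0nbhs_singleton L0nbhs_nbhs.

Lemma L0ball_conj (f : L0) (V : set G) (e : R) : open_nbhs 1%g V -> (0 < e)%R ->
  exists We : set G * R, (open_nbhs 1%g We.1 /\ (0 < We.2)%R) /\
    forall g, L0ball We g -> L0ball (V, e) (f^-1 * g * f)%g.
Proof.
move=> [oV V1] e0; have [B [oB bB]] := countable_base G.
pose good m n := B n 1%g /\ forall x y, B m x -> B n y -> V (x^-1 * y * x)%g.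
pose D m := [set x | B m x /\ exists n, good m n].
have oD m : open (D m).
  have [gm|ngm] := pselect (exists n, good m n).
    by rewrite (_ : D m = B m)//; apply/seteqP; split=> x // -[].
  rewrite (_ : D m = set0); first exact: open0.
  by apply/seteqP; split=> x // -[].
have Dcover x : exists m, D m x.
  have cx : (fun z : G * G => z.1^-1 * z.2 * z.1)%g @ (x, 1%g : G) -->
      (x^-1 * 1 * x)%g.
    have c1 : (fun z : G * G => z.1^-1)%g @ (x, 1%g : G) --> (x^-1)%g.
      apply: (@cvg_comp _ _ _ fst (fun z : G => z^-1)%g _ (nbhs x)).
        exact: cvg_fst.
      exact: (@invg_continuous G x).
    have c2 : (fun z : G * G => z.1^-1 * z.2)%g @ (x, 1%g : G) --> (x^-1 * 1)%g.
      apply: (@cvg_comp _ _ _ (fun z : G * G => (z.1^-1, z.2))%g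
        (fun z : G * G => (z.1 * z.2)%g) _ (nbhs (x^-1, 1)%g)).
        by apply: cvg_pair => //; exact: cvg_snd.
      exact: (@mulg_continuous G (x^-1, 1)%g).
    apply: (@cvg_comp _ _ _ (fun z : G * G => (z.1^-1 * z.2, z.1))%g
      (fun z : G * G => (z.1 * z.2)%g) _ (nbhs (x^-1 * 1, x)%g)).
      by apply: cvg_pair => //; exact: cvg_fst.
    exact: (@mulg_continuous G (x^-1 * 1, x)%g).
  have /cx : nbhs (x^-1 * 1 * x)%g V.
    by apply: open_nbhs_nbhs; split=> //; rewrite mulg1 mulVg.
  case=> -[P Q] /= [/bB[m [mx mP]] /bB[n [n1 nQ]]] PQV.
  exists m; split=> //; exists n; split=> // y z /mP Py /nQ Qz.
  exact: (PQV (y, z)).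
pose C N := [set x : lebesgueType | forall m, (m < N)%N -> ~ D m (f x)].
have mC N : measurable (C N).
  rewrite (_ : C N = \bigcap_(m in [set m | (m < N)%N]) [set x | ~ (~` D m) (f x) -> False]).
    apply: bigcap_measurableType => m _.
    rewrite (_ : mkset _ = ~` (L0_fun f @^-1` D m)); last first.
      by apply/seteqP; split=> x /= h // Dx; apply: h.
    apply: measurableC; rewrite -[_ @^-1` _]setTI.
    by apply: L0_measurable => //; exact: borel_open.
  apply/seteqP; split=> x /= Cx m mN; first by apply; exact: Cx.
  by move=> Dm; apply: (Cx m mN) => /(_ Dm).
have [N CN] : exists N, (mu01 (C N) < (e / 2)%:E)%E.
  have capC : \bigcap_n C n = set0.
    apply/seteqP; split=> x //= Cx; have [m Dm] := Dcover (f x).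
    exact: (Cx m.+1 I m (ltnSn m)).
  have : mu01 \o C @ \oo --> 0%E.
    rewrite -(measure0 mu01) -capC; apply: nonincreasing_cvg_mu => //.
    - rewrite (@le_lt_trans _ _ (mu01 setT))//; last by rewrite mu01T ltry.
      by apply: le_measure; rewrite ?inE.
    - exact: bigcap_measurableType.
    - by move=> n m nm; apply/subsetPset => x Cx k kn; apply: Cx; exact: leq_trans nm.
  have e20 : (0 < (e / 2)%:E)%E by rewrite lte_fin divr_gt0.
  move=> /(_ _ (open_ereal_lt' e20)) [N _ /(_ N (leqnn N))].
  by exists N.
have [W W1 WV] : exists2 W, open_nbhs 1%g W &
    forall m x y, (m < N)%N -> D m x -> W y -> V (x^-1 * y * x)%g.
  elim: N {CN} => [|N [W [oW W1] WV]]; first by exists setT => //; split=> //; exact: openT.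
  have [[n [Bn1 nV]]|ngN] := pselect (exists n, good N n).
    exists (W `&` B n); first by split; [exact: openI|split].
    move=> m x y; rewrite ltnS leq_eqVlt => /predU1P[->|mN] Dx [Wy By].
      by apply: nV => //; case: Dx.
    exact: WV mN Dx Wy.
  exists W => // m x y; rewrite ltnS leq_eqVlt => /predU1P[->|mN]; first by case.
  exact: WV.
exists (W, e / 2)%R; split=> /=; first by split=> //; rewrite divr_gt0.
move=> g gW; rewrite /L0ball /= [e]splitr EFinD.
have oW : open W by case: W1.
apply: le_lt_trans (lteD CN gW).
apply: le_trans (measureU2 _ (mC N) (measurable_L0bad g oW)).
apply: ae_le_mu01; [exact: measurable_L0bad| |].
  by apply: measurableU => //; exact: measurable_L0bad.
apply: filterS3 (L0_mulE (f^-1 * g)%g f) (L0_mulE f^-1%g g) (L0_invE f).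
move=> x E1 E2 E3 /=; rewrite E1 E2 E3 => nV; apply: contrapT => /not_orP[nC /contrapT Wg].
apply: nC => m mN Dx; apply: nV; exact: WV mN Dx Wg.
Qed.

Lemma L0mul_continuous : continuous (fun x : L0 * L0 => (x.1 * x.2)%g).
Proof.
move=> [f g] A /= [[V e] /= [V1 e0] VA].
have [W W1 WV] := mulg_open1 V1.
have e20 : (0 < e / 2)%R by rewrite divr_gt0.
have [Ud [Ud1 UW]] := L0ball_conj g W1 e20.
exists ([set f' | L0ball Ud (f^-1 * f')%g], [set g' | L0ball (W, e / 2)%R (g^-1 * g')%g]).
  by split; [exists Ud|exists (W, e / 2)%R].
move=> [f' g'] /= [/UW f'W g'W]; apply: VA => /=.
have -> : ((f * g)^-1 * (f' * g') = (g^-1 * (f^-1 * f') * g) * (g^-1 * g'))%g.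
  by rewrite invgM !mulgA mulgK.
rewrite [e]splitr; apply: L0ball_mul f'W g'W => //.
- by case: V1.
- by case: W1.
- by case: W1.
Qed.

Lemma L0inv_continuous : continuous (fun x : L0 => x^-1%g).
Proof.
move=> f A /= [[V e] /= [V1 e0] VA].
have [[W d] [/= [W1 d0] WV]] := L0ball_conj f^-1%g V1 e0.
exists ((fun x => x^-1)%g @^-1` W, d) => /=.
  case: W1 => oW W1; split=> //; split; last by rewrite /= invg1.
  by apply: open_comp => // x _; exact: invg_continuous.
move=> g /= gW; apply: VA => /=.
have -> : ((f^-1)^-1 * g^-1 = (f^-1)^-1 * (f^-1 * g)^-1 * f^-1)%g.
  by rewrite invgM !invgK -!mulgA mulgV mulg1.
by apply: WV; apply: L0ball_inv => //; case: W1.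
Qed.

HB.instance Definition _ :=
  isTopologicalGroup.Build L0 L0mul_continuous L0inv_continuous.

End L0.

(* Main.v *)
Require Import Defs.
From mathcomp Require Import all_boot all_order all_algebra.
From mathcomp Require Import all_classical all_reals all_analysis.

Set Implicit Arguments.
Unset Strict Implicit.
Unset Printing Implicit Defensive.

Import Order.TTheory GRing.Theory Num.Theory.
Import numFieldNormedType.Exports.

Local Open Scope classical_set_scope.

(** Suppose that <f> is neither precompact nor discrete; every tuple [g]
    topologically similar to [f] is shown to lie in a fixed countable union of
    nowhere dense sets.

    A tuple of automorphisms is thought of as acting on [M] by words in its
    entries and their inverses. Two features of [f] pass to [g], because they
    are visible in the topological group with the marked generators alone.
    First, <g> is not precompact. For subgroups of L0(Aut M), precompactness
    follows from total boundedness, as L0(Aut M) is complete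
    ([totally_bounded_precompact]); total boundedness carries over from <g> to
    <f>, and holds when almost every g(x) has finite orbits only
    ([finite_orbits_totally_bounded]). So there are [b] in [M] and e > 0 such
    that the orbit of [b] under g(x) is infinite with probability more than e.
    Second, if V is a small enough neighbourhood of 1, the words w with w(f)
    in V move [b] at [g] only with probability at most e.

    It remains to see that for fixed [b], e and V these two conditions define
    a nowhere dense set ([slow_tuples_nowhere_dense]), since countably many
    choices of ([b], e, V) suffice. To destroy the second condition by a small
    change of [g], keep only the restrictions of the g_i(x) to a finite
    algebraically closed set A. These take countably many values, and finitely
    many of them carry more than e of the event that the orbit of [b] is
    infinite. For such a value, the word action starting from [b] is a finite
    graph with missing edges, and as soon as the path of a reduced word meets
    a missing edge, the automorphisms can be chosen beyond A so that the word
    takes [b] to a new point: points outside an algebraically closed set have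
    infinite orbits over it, and a reduced word never turns back
    ([free_extension]). As f is not discrete, there is a nontrivial word w0
    with w0(f) as close to 1 as desired, and a conjugate of w0 by a word that
    runs into missing edges of all the graphs is reduced, moves [b] in all of
    them, and still takes [f] into V ([moving_word]). *)

(** * Words *)

Lemma filter_allI (T : Type) (F : set_system T) (I : eqType) (s : seq I)
    (P : I -> set T) : Filter F ->
  (forall i, i \in s -> F (P i)) -> F [set x | forall i, i \in s -> P i x].
Proof.
move=> FF; elim: s => [_|i s ih FP]; first exact: filterE.
have FPs : F [set x | forall j, j \in s -> P j x].
  by apply: ih => j js; apply: FP; rewrite inE js orbT.
apply: filterS2 (FP i (mem_head _ _)) FPs => x Pi Ps j.
by rewrite inE => /predU1P[->|/Ps].
Qed.

Section words.
Variable n : nat.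

Definition letter := ('I_n * bool)%type.
Implicit Types (s t : letter) (u v w : seq letter).

Definition linv s : letter := (s.1, ~~ s.2).
Definition winv w := rev (map linv w).

Lemma linvK : involutive linv.
Proof. by case=> i b; rewrite /linv /= negbK. Qed.

Lemma linv_neq s : linv s != s.
Proof. by case: s => i [] ; rewrite /linv xpair_eqE eqxx. Qed.

Definition reduced w := sorted (fun s t => t != linv s) w.

Definition reduce := foldr (fun s w =>
  if w is t :: v then if t == linv s then v else s :: w else [:: s]) [::].

Lemma reducedP w : reduced (reduce w).
Proof.
elim: w => //= s w; rewrite -/(reduce w); case: (reduce w) => [|t v] //=.
case: ifP => [_|/negbT st]; last by rewrite /reduced /= st.
by rewrite /reduced; case: v => //= r v /andP[].
Qed.

Lemma reduced_winv w : reduced w -> reduced (winv w).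
Proof.
rewrite /reduced /winv rev_sorted; elim: w => // s [|t w] //= ih /andP[ts /ih].
rewrite /= => ->; rewrite andbT; apply: contra ts => /eqP ts.
by rewrite ts linvK.
Qed.

Section evaluation.
Variables (H : groupType) (g : 'I_n -> H).

Definition evl s : H := if s.2 then g s.1 else (g s.1)^-1%g.

(** The product is taken in reverse order, so that the first letter of a word
    is the first to act on a point. *)
Definition evw w : H := foldr (fun s x => x * evl s)%g 1%g w.

Lemma evl_inv s : evl (linv s) = (evl s)^-1%g.
Proof. by case: s => i []; rewrite /evl //= invgK. Qed.

Lemma evw_cat u v : evw (u ++ v) = (evw v * evw u)%g.
Proof. by elim: u => [|s u /= ->]; rewrite ?mulg1 // mulgA. Qed.

Lemma evw_winv w : evw (winv w) = (evw w)^-1%g.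
Proof.
elim: w => [|s w ih] /=; first by rewrite invg1.
by rewrite /winv /= rev_cons -cats1 evw_cat /= mul1g evl_inv invgM -ih.
Qed.

Lemma evw_reduce w : evw (reduce w) = evw w.
Proof.
elim: w => //= s w <-; rewrite -/(reduce w); case: (reduce w) => [|t v] //=.
by case: ifP => //= /eqP ->; rewrite evl_inv mulgVK.
Qed.

End evaluation.

Lemma generated_subgroupE (H : topologicalGroupType) (g : 'I_n -> H) :
  generated_subgroup g = range (evw g).
Proof.
apply/seteqP; split=> [x|_ [w _ <-]].
  apply; split; last by move=> _ [i _ <-]; exists [:: (i, true)]; rewrite //= /evl mul1g.
  split; first by exists [::].
    by move=> _ _ [u _ <-] [v _ <-]; exists (v ++ u) => //; rewrite evw_cat.
  by move=> _ [u _ <-]; exists (winv u) => //; rewrite evw_winv.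
move=> B [[B1 BM BV] gB]; elim: w => //= s w ih; apply: BM => //.
by rewrite /evl; case: ifP => _; [|apply: BV]; apply: gB; exists s.1.
Qed.

End words.

(** * Algebraic closure and orbits *)

Section algebraic_closure.
Context (L : language) (M : countType) (S : structure L M).
Implicit Types (A X : set M) (g h : aut S) (a b c y : M).

Local Notation Stab := (@pointwise_stabilizer L M S).

Lemma autME g h a : ((g * h)%g : aut S) a = g (h a). Proof. by []. Qed.

Lemma aut_mulVK g a : (g^-1)%g (g a) = a.
Proof. by rewrite -autME mulVg. Qed.

Lemma aut_mulKV g a : g ((g^-1)%g a) = a.
Proof. by rewrite -autME mulgV. Qed.

Definition orb (H : set (aut S)) c : set M := [set (g : aut S) c | g in H].

Lemma stabS A X : A `<=` X -> Stab X `<=` Stab A.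
Proof. by move=> AX g gX a /AX /gX. Qed.

Lemma stabV A g : Stab A g -> Stab A (g^-1)%g.
Proof. by move=> gA a Aa; rewrite -{1}(gA _ Aa) aut_mulVK. Qed.

Lemma stabM A g h : Stab A g -> Stab A h -> Stab A (g * h)%g.
Proof. by move=> gA hA a Aa; rewrite autME (hA _ Aa) (gA _ Aa). Qed.

(** The orbit of [c] is covered by translates of its orbit under the smaller
    stabilizer, one for each point of the orbit of [y]. *)
Lemma orb_finite_step X y c : finite_set (orb (Stab X) y) ->
  finite_set (orb (Stab (y |` X)) c) -> finite_set (orb (Stab X) c).
Proof.
move=> fy fc.
have /choice[k kP] y' : exists g : aut S, orb (Stab X) y y' -> Stab X g /\ g y = y'.
  have [[g gX gy]|no] := pselect (orb (Stab X) y y').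
    by exists g.
  by exists 1%g => /no.
apply: (@sub_finite_set _ _ (\bigcup_(y' in orb (Stab X) y)
   (k y' @` orb (Stab (y |` X)) c))).
  move=> _ [g gX <-]; have Oy : orb (Stab X) y (g y) by exists g.
  exists (g y) => //; have [kX ky] := kP _ Oy.
  exists (((k (g y))^-1 * g)%g c); last by rewrite autME aut_mulKV.
  exists ((k (g y))^-1 * g)%g => // a [->|Xa].
    by rewrite autME -{2}ky aut_mulVK.
  by apply: (stabM (stabV kX) gX).
by apply: bigcup_finite => // y' _; exact: finite_image.
Qed.

Lemma orb_finite_seq (s : seq M) X c :
  (forall y, y \in s -> finite_set (orb (Stab X) y)) ->
  finite_set (orb (Stab ([set` s] `|` X)) c) -> finite_set (orb (Stab X) c).
Proof.
elim: s X => [|y s ih] X fX.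
  by apply: sub_finite_set; apply: image_subset; apply: stabS => a [].
move=> fc; apply: (@orb_finite_step _ y); first by apply: fX; rewrite mem_head.
apply: ih => [z zs|]; last first.
  apply: sub_finite_set fc; apply: image_subset; apply: stabS => a.
  by move=> [|Xa]; [rewrite /= inE => /predU1P[->|]|]; [right; left|left|right; right].
apply: sub_finite_set (fX z _); last by rewrite inE zs orbT.
by apply: image_subset; apply: stabS => a; right.
Qed.

Definition acl_closed A := forall b, ~ A b -> infinite_set (orb (Stab A) b).

Lemma sub_acl A : A `<=` acl S A.
Proof.
move=> a Aa; apply: (@sub_finite_set _ _ [set a]); last exact: finite_set1.
by move=> _ [g gA <-]; exact: gA.
Qed.

(** Each point of [acl S A] has a finite orbit over [A], so fixing all the
    finitely many of them costs only finitely many cosets. *)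
Lemma acl_closed_acl A : finite_set (acl S A) -> acl_closed (acl S A).
Proof.
move=> /[dup] /finite_seqP[s sE] _ b nb; apply: contra_not nb => fb.
apply: (@orb_finite_seq s) => [y ys|].
  by have : acl S A y by rewrite sE.
apply: sub_finite_set fb; apply: image_subset; apply: stabS => a Aa; left.
by rewrite -sE.
Qed.

Lemma acl_closed_image A g : acl_closed A -> acl_closed (g @` A).
Proof.
move=> rA b nb; have /rA : ~ A ((g^-1)%g b).
  by apply: contra_not nb => Ab; exists ((g^-1)%g b) => //; rewrite aut_mulKV.
apply: contra_not => fb; apply: sub_finite_set (finite_image (g^-1)%g fb).
move=> _ [h hA <-]; exists ((g * h * g^-1)%g b); last by rewrite !autME aut_mulVK.
exists (g * h * g^-1)%g => // _ [a Aa <-].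
by rewrite !autME aut_mulVK (hA _ Aa).
Qed.

(** * Extending partial automorphisms freely along a word *)

Section free_extension.
Hypothesis finite_acl : forall A, finite_set A -> finite_set (acl S A).
Variable n : nat.
Implicit Types (w u v : seq (letter n)) (s t : letter n).

Lemma evl_invK (g : 'I_n -> aut S) s y : evl g (linv s) (evl g s y) = y.
Proof. by rewrite -autME evl_inv mulVg. Qed.

Lemma evl_falseKV (g : 'I_n -> aut S) i y : g i (evl g (i, false) y) = y.
Proof. exact: (evl_invK g (i, false) y). Qed.

Lemma evl_falseK (g : 'I_n -> aut S) i y : evl g (i, false) (g i y) = y.
Proof. exact: (evl_invK g (i, true) y). Qed.

Lemma evw_consE (g : 'I_n -> aut S) s w b : evw g (s :: w) b = evw g w (evl g s b).
Proof. by []. Qed.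

Lemma evw_catE (g : 'I_n -> aut S) u v b : evw g (u ++ v) b = evw g v (evw g u b).
Proof. by rewrite evw_cat. Qed.

Lemma evw_rconsE (g : 'I_n -> aut S) u s b : evw g (rcons u s) b = evl g s (evw g u b).
Proof. by rewrite -cats1 evw_catE. Qed.

(** [D s] is the domain on which the action of the letter [s] is prescribed;
    the prescribed partial maps of a letter and of its inverse are inverse to
    each other. *)
Definition domain_system (g : 'I_n -> aut S) (D : letter n -> set M) :=
  forall s, [/\ finite_set (D s), acl_closed (D s) &
                D (linv s) = evl g s @` D s].

(** The first letter takes [b] to a point that may be chosen outside any given
    finite set. Chosen outside all the current domains, it is a point where
    the next letter is undetermined again, because this letter is not the
    inverse of the first one. *)
Lemma free_extension w (g : 'I_n -> aut S) D b (F : set M) :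
  reduced w -> domain_system g D -> finite_set F ->
  (if w is s :: _ then ~ D s b else False) ->
  exists2 h : 'I_n -> aut S, (forall s y, D s y -> evl h s y = evl g s y) &
    ~ F (evw h w b).
Proof.
elim: w g D b => // s w ih g D b rw gD fF nDb.
have [fDs clDs _] := gD s.
have finD' : finite_set (acl S (b |` D s)) by apply: finite_acl; rewrite finite_setU; split.
have finB : finite_set (F `|` (acl S (b |` D s) `|` \bigcup_(t in setT) D t)).
  rewrite !finite_setU; split => //; split => //.
  by apply: bigcup_finite => [|t _]; [exact: finite_finset|case: (gD t)].
(* The range of the prescribed map of [s] is algebraically closed, so the image
   of [b], which lies outside, can be moved off a finite set. *)
have [k kS kb] : exists2 k, Stab (D (linv s)) k &
    ~ (F `|` (acl S (b |` D s) `|` \bigcup_(t in setT) D t)) (k (evl g s b)).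
  have [_ + _] := gD (linv s) => /(_ (evl g s b)) inf.
  have : ~ D (linv s) (evl g s b).
    have [_ _ ->] := gD s; move=> [y Dy /(bij_inj (aut_bij _)) yb].
    by apply: nDb; rewrite -yb.
  move=> /inf; apply: contra_notP => no; apply: sub_finite_set finB.
  by move=> _ [k kS <-]; apply: contrapT => kb; apply: no; exists k.
set b' := k (evl g s b) in kb.
pose x := (k * evl g s)%g.
pose g' j := if j == s.1 then (if s.2 then x else x^-1%g) else g j.
pose D' t := if t == s then acl S (b |` D s)
             else if t == linv s then x @` acl S (b |` D s) else D t.
have Es : evl g' s = x by rewrite /evl /g' eqxx; case: s.2; rewrite ?invgK.
have Et t : t != s -> t != linv s -> evl g' t = evl g t.
  move=> ts tls; have : t.1 != s.1.
    apply/eqP => ts1; move: ts tls ts1; clear; case: t s => [i bt] [j bs] /=.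
    move=> + + ij; rewrite ij /linv /= !xpair_eqE eqxx.
    by case: bt bs => [] [].
  by rewrite /evl /g' => /negbTE ->.
have xD y : D s y -> x y = evl g s y.
  by move=> Dy; rewrite autME kS//; have [_ _ ->] := gD s; exists y.
have agree t y : D t y -> evl g' t y = evl g t y.
  have [->|ts] := eqVneq t s; first by rewrite Es; exact: xD.
  have [->|tls] := eqVneq t (linv s); last by rewrite Et.
  have [_ _ ->] := gD s; move=> [z Dz <-].
  by rewrite evl_invK -{1}(xD _ Dz) -Es evl_invK.
have DD' t : D t `<=` D' t.
  move=> y Dy; rewrite /D'; have [ts|_] := eqVneq t s.
    by apply: sub_acl; right; rewrite -ts.
  have [tls|//] := eqVneq t (linv s).
  move: Dy; rewrite tls; have [_ _ ->] := gD s; move=> [z Dz <-].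
  by exists z; [apply: sub_acl; right|exact: xD].
have gD' : domain_system g' D'.
  move=> t; rewrite /D'; have [->|ts] := eqVneq t s.
    rewrite eqxx (negbTE (linv_neq s)) Es; split=> //; exact: acl_closed_acl.
  have [->|tls] := eqVneq t (linv s).
    rewrite linvK eqxx; split.
    - exact: finite_image.
    - by apply: acl_closed_image; exact: acl_closed_acl.
    - apply/seteqP; split=> [y Ay|_ [_ [y Ay <-] <-]].
        by exists (x y); [exists y|rewrite -Es evl_invK].
      by rewrite -Es evl_invK.
  rewrite !(inv_eq (@linvK n)) (negbTE tls) linvK (negbTE ts) Et//; exact: gD.
case: w ih rw => [_ _|t w /(_ g' D' b') ih /andP[ts rw]].
  exists g' => //; rewrite evw_consE Es => Fb; apply: kb; left; exact: Fb.
have [|h hD' hF] := ih rw gD' fF.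
  rewrite /D'; have [_|_] := eqVneq t s; first by move=> h; apply: kb; right; left.
  by rewrite (negbTE ts) => Db; apply: kb; right; right; exists t.
exists h; first by move=> r y Dy; rewrite hD' ?agree //; exact: DD'.
rewrite evw_consE hD' ?Es //.
by rewrite /D' eqxx; apply: sub_acl; left.
Qed.

(** The path of the word [w] from [b] reaches a point where the next letter is
    not determined by the prescribed partial maps. *)
Fixpoint leaves (g : 'I_n -> aut S) (D : letter n -> set M) b w : Prop :=
  if w is s :: w then ~ D s b \/ leaves g D (evl g s b) w else False.

Lemma leaves_cat (g : 'I_n -> aut S) D b u v : leaves g D b (u ++ v) <->
  leaves g D b u \/ leaves g D (evw g u b) v.
Proof.
elim: u b => [|s u ih] b /=; first by split=> [|[]]//; right.
split=> [[|/ih[]]|[[]|]]; rewrite ?autME; try by [left; left|left; right|right].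
- by left.
- by move=> h; right; apply/ih; left.
- by move=> h; right; apply/ih; right.
Qed.

Lemma leaves_moves w (g : 'I_n -> aut S) D b c : reduced w -> domain_system g D ->
  leaves g D b w ->
  exists2 h : 'I_n -> aut S, (forall s y, D s y -> evl h s y = evl g s y) &
    evw h w b <> c.
Proof.
move=> + gD; elim: w b => // s w ih b rw /= [nD|].
  exact: (@free_extension (s :: w) g D b [set c]).
have [nD _|/contrapT Db lw] := pselect (~ D s b).
  exact: (@free_extension (s :: w) g D b [set c]).
have [|h hD hc] := ih _ _ lw; first by move: rw => /path_sorted.
by exists h => //; rewrite hD.
Qed.

(** Stated through a finite invariant set rather than the orbit itself, which
    makes the condition a countable union of clopen ones. *)
Definition finite_orbit (g : 'I_n -> aut S) b := exists2 X : seq M, b \in X &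
  forall s y, y \in X -> evl g s y \in X.

Lemma evw_nseq (g : 'I_n -> aut S) k s : evw g (nseq k s) = (evl g s ^+ k)%g.
Proof. by elim: k => //= k ->; rewrite expgSr. Qed.

Lemma periodic (g : aut S) b (X : seq M) : (forall k, (g ^+ k)%g b \in X) ->
  exists m, (g ^+ m.+1)%g b = b.
Proof.
move=> gX; have : ~~ uniq [seq (g ^+ k)%g b | k <- iota 0 (size X).+1].
  apply/negP => /uniq_leq_size leX; have /leX : {subset
      [seq (g ^+ k)%g b | k <- iota 0 (size X).+1] <= X}.
    by move=> _ /mapP[k _ ->].
  by rewrite size_map size_iota ltnn.
move=> /(uniqPn b)[i [j [ij]]]; rewrite size_map size_iota => jX.
rewrite !(nth_map 0%N) ?size_iota ?(ltn_trans ij)// !nth_iota ?(ltn_trans ij)//.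
rewrite !add0n => gij; exists (j - i).-1; rewrite prednK ?subn_gt0//.
apply: (bij_inj (aut_bij (g ^+ i)%g)).
by rewrite -autME -expgnDr subnKC // ltnW.
Qed.

(** Leaving is possible even without turning back on a previous letter [s].
    Otherwise the words [v] with [s :: v] reduced would reach only finitely
    many points from [b], and these form an invariant set: a further letter
    either prolongs the word, or cancels its last letter, or is the inverse of
    [s] applied to [b] itself; in the last case the same point is reached by a
    power of [s], as the powers of [s] return to [b]. *)
Lemma leaves_from (g : 'I_n -> aut S) D b s : domain_system g D ->
  ~ finite_orbit g b ->
  exists2 v, reduced (s :: v) & leaves g D b v.
Proof.
move=> gD; apply: contra_notP => no.
pose X := [set evw g v b | v in [set v | reduced (s :: v)]].
have fX : finite_set X.
  apply: (@sub_finite_set _ _ (b |` \bigcup_(t in setT) D t)); last first.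
    rewrite finite_setU; split => //.
    by apply: bigcup_finite => [|t _]; [exact: finite_finset|case: (gD t)].
  move=> _ [v rv <-]; case: (lastP v) rv => [|{}v t] rv; first by left.
  right; exists (linv t) => //; have [_ _ ->] := gD t.
  rewrite evw_rconsE; exists (evw g v b) => //.
  apply: contrapT => nD; apply: no; exists (rcons v t) => //.
  by rewrite -cats1; apply/leaves_cat; right; left.
have ss k : reduced (s :: nseq k s).
  by rewrite /reduced /=; elim: k => //= k ->; rewrite eq_sym linv_neq.
have /finite_seqP[xs xsE] := fX.
have inX y : (y \in xs) = (y \in X) by apply/idP/idP; rewrite inE xsE.
exists xs; first by rewrite inX inE; exists [::].
move=> t y; rewrite !inX !inE => -[v rv <-].
have [tl|tl] := eqVneq t (linv (last s v)); last first.
  exists (rcons v t); first by rewrite /reduced /= rcons_path; apply/andP; split.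
  by rewrite evw_rconsE.
case: (lastP v) rv tl => [_ /= tl|{}v l]; last first.
  rewrite last_rcons => rv ->; exists v.
    by move: rv; rewrite /reduced /= rcons_path => /andP[].
  by rewrite evw_rconsE evl_invK.
have [k|m mb] := @periodic (evl g s) b xs.
  by rewrite inX inE; exists (nseq k s); rewrite ?evw_nseq //; exact: ss.
exists (nseq m s); first exact: ss.
by rewrite evw_nseq tl -{2}mb expgS autME evl_invK.
Qed.

End free_extension.
End algebraic_closure.

(** * Words close to the identity that move a point *)

Section more_words.
Variable n : nat.
Implicit Types (s t c : letter n) (u v w : seq (letter n)).

Lemma reduced_cat_last s u v : reduced u -> reduced (last s u :: v) ->
  reduced (u ++ v).
Proof.
rewrite /reduced; case: u => [_ /path_sorted //|x u] /=.
by rewrite cat_path => -> ->.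
Qed.

Lemma reduced_rcons_cat u c s w : reduced (rcons u c ++ s :: w) =
  [&& reduced (rcons u c), s != linv c & reduced (s :: w)].
Proof.
by rewrite /reduced; case: u => [|x u] //=; rewrite cat_path /= last_rcons.
Qed.

Lemma reduced_conj u c w s : reduced (rcons u c) -> reduced w -> w != [::] ->
  head s w != linv c -> last s w != c ->
  reduced (rcons u c ++ w ++ winv (rcons u c)).
Proof.
case: w => // t w ruc rw _ /= tc lc; rewrite reduced_rcons_cat ruc tc /=.
have -> : winv (rcons u c) = linv c :: winv u by rewrite /winv map_rcons rev_rcons.
rewrite /reduced /= cat_path; apply/andP; split; first exact: rw.
apply/andP; split; last first.
  by have /reduced_winv := ruc; rewrite /winv map_rcons rev_rcons.
by rewrite (inj_eq (inv_inj (@linvK n))) eq_sym.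
Qed.

Lemma letter_avoid (a b d : letter n) : (1 < n)%N ->
  exists c : letter n, c \notin [:: a; b; d].
Proof.
move=> n1; apply/existsP; apply: contraT; rewrite negb_exists => /forallP all3.
have /uniq_leq_size le3 := enum_uniq {: 'I_n * bool}.
have /le3 : {subset enum {: 'I_n * bool} <= [:: a; b; d]}.
  by move=> c _; have := all3 c; rewrite negbK.
by rewrite -cardE card_prod card_bool card_ord /=; case: n n1 => [|[|[]]].
Qed.

End more_words.

Section nondiscrete.
Context (K : topologicalGroupType) (n : nat) (f : 'I_n -> K).

Lemma nbhs_mulg (x y : K) V : nbhs (x * y)%g V -> nbhs y [set z | V (x * z)%g].
Proof.
move=> Vxy; have cl : (fun z => (x * z)%g) @ y --> (x * y)%g.
  apply: (@cvg_comp _ _ _ (fun z => (x, z)) (fun z : K * K => (z.1 * z.2)%g)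
     _ (nbhs (x, y))); last exact: (@mulg_continuous K (x, y)).
  by apply: cvg_pair => //; exact: cvg_cst.
exact: cl Vxy.
Qed.

Lemma nbhs_conj (k : K) V : nbhs (1%g : K) V ->
  nbhs (1%g : K) [set y | V (k^-1 * y * k)%g].
Proof.
move=> V1; have cl : (fun y => (k^-1 * y * k)%g) @ (1 : K)%g --> (1 : K)%g.
  rewrite -[X in _ --> X](mulVg k) -{2}(mulg1 (k^-1)%g).
  apply: (@cvg_comp _ _ _ (fun y => (k^-1 * y, k)%g) (fun z : K * K => (z.1 * z.2)%g)
     _ (nbhs (k^-1 * 1, k)%g)); last exact: (@mulg_continuous K (k^-1 * 1, k)%g).
  apply: cvg_pair => //; last exact: cvg_cst.
  apply: (@cvg_comp _ _ _ (fun y => (k^-1, y)%g) (fun z : K * K => (z.1 * z.2)%g)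
     _ (nbhs (k^-1, 1)%g)); last exact: (@mulg_continuous K (k^-1, 1)%g).
  by apply: cvg_pair => //; exact: cvg_cst.
exact: cl V1.
Qed.

Lemma nondiscrete_words V : ~ discrete_set (generated_subgroup f) ->
  nbhs (1%g : K) V -> exists2 w, V (evw f w) & evw f w <> 1%g.
Proof.
move=> nd V1; apply: contrapT => no; apply: nd => x.
rewrite openE => _ ->.
have nx : nbhs (set_val x) [set y | V ((set_val x)^-1 * y)%g] by apply: nbhs_mulg; rewrite mulVg.
have : nbhs x (set_val @^-1` [set y | V ((set_val x)^-1 * y)%g]).
  exact: (@initial_continuous _ _ (set_val : generated_subgroup f -> K) x _ nx).
apply: filterS => y /= Vxy; apply/val_inj => /=; apply: contrapT => xy.
have gw (z : generated_subgroup f) : exists w, evw f w = set_val z.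
  have : generated_subgroup f (set_val z) by apply/set_mem; exact: valP.
  have : generated_subgroup f `<=` range (evw f) by rewrite generated_subgroupE.
  by move=> /[apply] -[w _ wz]; exists w.
have [[v vy] [u ux]] := (gw y, gw x); apply: no; exists (v ++ winv u).
  by rewrite evw_cat evw_winv vy ux.
rewrite evw_cat evw_winv vy ux => /(congr1 (fun z => val x * z)%g).
by rewrite mulg1 mulVKg.
Qed.

(** The prefix [u] is given beforehand and [c] has finitely many values, so a
    single neighbourhood of 1 takes care of all these conjugates. *)
Lemma nondiscrete_conj_words V u : ~ discrete_set (generated_subgroup f) ->
  nbhs (1%g : K) V -> exists2 w, reduced w /\ w != [::] & V (evw f w) /\
   forall c, V (evw f (rcons u c ++ w ++ winv (rcons u c))).
Proof.
move=> nd V1.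
have : nbhs (1%g : K) (V `&` [set y | forall c : letter n,
    c \in enum {: 'I_n * bool} ->
    V ((evw f (winv (rcons u c)) * y * (evw f (winv (rcons u c)))^-1)%g)]).
  apply: filterI => //.
  apply: (@filter_allI _ (nbhs (1%g : K)) _ (enum {: 'I_n * bool}) (fun c => [set y |
    V (evw f (winv (rcons u c)) * y * (evw f (winv (rcons u c)))^-1)%g])) => c _.
  rewrite /= -{1}[evw f (winv _)]invgK; exact: nbhs_conj.
move=> /(nondiscrete_words nd)[w [Vw cw] w1]; exists (reduce w).
  split; first exact: reducedP.
  by apply: contra_notN w1 => /eqP w0; rewrite -evw_reduce w0.
split=> [|c]; first by rewrite evw_reduce.
by have := cw c (mem_enum _ _); rewrite /= !evw_cat !evw_winv evw_reduce invgK.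
Qed.

End nondiscrete.

Section moving.
Context (L : language) (M : countType) (S : structure L M).
Hypothesis finite_acl : forall A, finite_set A -> finite_set (acl S A).
Context (n : nat).
Hypothesis n_gt0 : (0 < n)%N.
Implicit Types (g h : 'I_n -> aut S) (D : letter n -> set M) (b : M).

Lemma finite_orbit_evw g b u : finite_orbit g (evw g u b) -> finite_orbit g b.
Proof.
move=> [X Xb gX]; exists X => //; elim/last_ind: u Xb => // u s ih.
by rewrite evw_rconsE => /(gX (linv s)); rewrite evl_invK => /ih.
Qed.

(** A word that leaves some of the partial actions is prolonged to leave one
    more; the prolongation stays reduced by [leaves_from]. *)
Lemma common_leaving (r : nat) (gs : nat -> 'I_n -> aut S)
    (Ds : nat -> letter n -> set M) b :
  (forall k, (k < r)%N -> domain_system (gs k) (Ds k) /\ ~ finite_orbit (gs k) b) ->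
  exists2 u, reduced u & forall k, (k < r)%N -> leaves (gs k) (Ds k) b u.
Proof.
elim: r => [_|r ih gD]; first by exists [::].
have [k kr|u ru lu] := ih; first by apply: gD; exact: ltnW.
pose s : letter n := last (Ordinal n_gt0, true) u.
have [gDr nf] := gD r (ltnSn r).
have [|v rv lv] := @leaves_from _ _ _ n (gs r) (Ds r) (evw (gs r) u b) s gDr.
  by apply: contra_not nf; exact: finite_orbit_evw.
exists (u ++ v); first exact: reduced_cat_last rv.
move=> k; rewrite ltnS leq_eqVlt => /predU1P[->|kr]; apply/leaves_cat.
  by right.
by left; exact: lu.
Qed.

(** With a single generator a reduced word is a power of a letter, and a fixed
    point of such a power has a finite orbit. *)
Lemma infinite_orbit_one_letter w g b : n = 1%N -> ~ finite_orbit g b ->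
  reduced w -> w != [::] -> evw g w b <> b.
Proof.
move=> n1 nf; case: w => // s w rw _.
have letters t : t = s \/ t = linv s.
  have ord_0 (i : 'I_n) : val i = 0%N.
    by case: i => i ip /=; move: (ip); rewrite n1 ltnS leqn0 => /eqP.
  have : t.1 = s.1 by apply/val_inj; rewrite !ord_0.
  by clear; case: t s => [i []] [j []] /= ->; [left|right|right|left].
have wE : s :: w = nseq (size w).+1 s.
  rewrite /=; congr cons; elim: w rw => //= t w ih; rewrite /reduced /= => /andP[ts].
  have [->|tE] := letters t; last by rewrite tE eqxx in ts.
  by move=> /ih {1}->.
rewrite wE evw_nseq; set m := (size w).+1 => gb; apply: nf.
have inX k : (k < m)%N -> (evl g s ^+ k)%g b \in
    [seq (evl g s ^+ k)%g b | k <- iota 0 m].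
  by move=> km; apply/mapP; exists k; rewrite ?mem_iota.
exists [seq (evl g s ^+ k)%g b | k <- iota 0 m]; first exact: (inX 0%N).
move=> t _ /mapP[k + ->]; rewrite mem_iota add0n => /andP[_ km].
have [->|->] := letters t.
  rewrite -autME -expgS; have [km1|mk] := ltnP k.+1 m; first exact: inX.
  have -> : k.+1 = m by apply/eqP; rewrite eqn_leq km mk.
  by rewrite gb; exact: (inX 0%N).
case: k km => [|k] km; last first.
  by rewrite expgS autME evl_invK; apply: inX; exact: ltnW.
have -> : (evl g s ^+ 0)%g b = b by [].
rewrite -{1}gb expgS autME evl_invK; exact: inX.
Qed.

(** The word [w] found is a conjugate of a nontrivial word close to 1 by a word
    which leaves all the partial actions [gs k]; one more letter [c] in between
    avoids cancellations. It must differ from three given letters, and with a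
    single generator there are only two, so that case is treated apart. *)
Lemma moving_word (K : topologicalGroupType) (f : 'I_n -> K) V r
    (gs : nat -> 'I_n -> aut S) (Ds : nat -> letter n -> set M) b :
  ~ discrete_set (generated_subgroup f) -> nbhs (1%g : K) V ->
  (forall k, (k < r)%N -> domain_system (gs k) (Ds k) /\ ~ finite_orbit (gs k) b) ->
  exists2 w, V (evw f w) & forall k, (k < r)%N ->
    exists2 h : 'I_n -> aut S, (forall s y, Ds k s y -> evl h s y = evl (gs k) s y) &
      evw h w b <> b.
Proof.
move=> nd V1 gD; have [u ru lu] := common_leaving gD.
have [w [rw w0] [Vw Vc]] := nondiscrete_conj_words u nd V1.
have [n1|n1] := leqP n 1.
  exists w => // k kr; exists (gs k) => //.
  have [_ nf] := gD k kr; apply: infinite_orbit_one_letter => //.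
  by apply/eqP; rewrite eqn_leq n1.
pose s0 : letter n := (Ordinal n_gt0, true).
have [c] := letter_avoid (linv (last s0 u)) (linv (head s0 w)) (last s0 w) n1.
rewrite !inE !negb_or => /and3P[cu ch cl].
exists (rcons u c ++ w ++ winv (rcons u c)); first exact: Vc.
move=> k kr; have [gDk nf] := gD k kr.
apply: leaves_moves => //; last first.
  by rewrite cat_rcons; apply/leaves_cat; left; exact: lu.
apply: (reduced_conj (s := s0)) => //; last by rewrite eq_sym.
  rewrite -cats1; apply: (@reduced_cat_last _ s0) => //.
  by rewrite /reduced /= cu.
by apply: contra ch => /eqP ->; rewrite linvK.
Qed.

End moving.

(** * Measurability and approximation *)

Section measurability.
Context d (X : measurableType d).

Lemma measurable_exists (T : countType) (P : T -> set X) :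
  (forall t, measurable (P t)) -> measurable [set x | exists t, P t x].
Proof.
move=> mP; rewrite (_ : mkset _ = \bigcup_(k in [set: nat])
    (if unpickle k is Some t then P t else set0)).
  by apply: bigcup_measurable => k _; case: unpickle.
apply/seteqP; split=> [x [t Px]|x [k _]]; first by exists (pickle t); rewrite ?pickleK.
by case: unpickle => // t; exists t.
Qed.

Lemma measurable_forall (T : countType) (P : T -> set X) :
  (forall t, measurable (P t)) -> measurable [set x | forall t, P t x].
Proof.
move=> mP; rewrite (_ : mkset _ = ~` [set x | exists t, ~ P t x]).
  by apply: measurableC; apply: measurable_exists => t; exact: measurableC.
by apply/seteqP; split=> x /=; [move=> h [t]; exact|move=> /forallNP h t; apply: contrapT].
Qed.

Lemma measurable_constant_imply (A : Prop) (P : set X) :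
  (A -> measurable P) -> measurable [set x | A -> P x].
Proof.
move=> mP; have [a|na] := pselect A.
  by rewrite (_ : mkset _ = P); [exact: mP|apply/seteqP; split=> x /= h; [exact: h|by []]].
by rewrite (_ : mkset _ = setT)//; apply/seteqP; split=> x //= _ /na.
Qed.

Lemma measurable_constant_and (A : Prop) (P : set X) :
  measurable P -> measurable [set x | A /\ P x].
Proof.
move=> mP; have [a|na] := pselect A.
  by rewrite (_ : mkset _ = P)//; apply/seteqP; split=> x //= -[].
by rewrite (_ : mkset _ = set0)//; apply/seteqP; split=> x //= -[].
Qed.

Lemma approx_from_below (R : realType) (mu : {measure set X -> \bar R}%R)
    (T : countType) (P : T -> set X) (c : \bar R) :
  (forall t, measurable (P t)) -> (c < mu [set x | exists t, P t x])%E ->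
  exists r, (c < mu [set x | exists2 t, (pickle t < r)%N & P t x])%E.
Proof.
move=> mP; set F := fun r => [set x | exists2 t : T, (pickle t < r)%N & P t x].
have mF r : measurable (F r).
  rewrite (_ : F r = [set x | exists t, (pickle t < r)%N /\ P t x]).
    by apply: measurable_exists => t; exact: measurable_constant_and.
  by apply/seteqP; split=> x [t]; [exists t|case; exists t].
have FE : \bigcup_n F n = [set x | exists t, P t x].
  apply/seteqP; split=> [x [r _ [t _]]|x [t Px]]; first by exists t.
  by exists (pickle t).+1 => //; exists t.
move=> cF; have : mu \o F @ \oo --> mu [set x | exists t, P t x].
  rewrite -FE; apply: nondecreasing_cvg_mu => //; first exact: bigcup_measurable.
  move=> a b ab; apply/subsetPset => x [t ta Px]; exists t => //.
  exact: leq_trans ab.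
move=> /(_ _ (open_ereal_gt' cF))[r _ /(_ r (leqnn r)) cr].
by exists r.
Qed.

End measurability.

(** * Convergence in measure of random automorphisms *)

Section L0_aut.
Context (R : realType) (L : language) (M : countType) (S : structure L M).
Local Notation G := (aut S).
Local Notation K := (L0 R G).
Local Notation mu := (@mu01 R).
Implicit Types (f g h : K) (F : seq M) (a b : M).

Lemma open_cylinder F t : open [set h : G | map h F = t].
Proof.
rewrite openE => h hF; elim: F t hF => [|a F ih] t /=; first by move=> <-; exact: filterE.
move=> <-; have := ih _ erefl; apply: filterS2 (near_aut h a) => h' /= -> hF.
by rewrite -hF.
Qed.

Lemma nbhs1_aut (V : set G) : nbhs (1%g : G) V ->
  exists F, forall h : G, map h F = F -> V h.
Proof.
move=> V1; pose B := filter_from [set: seq M] (fun F => [set h : G | map h F = F]).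
have FB : Filter B.
  apply: filter_from_filter; first by exists [::].
  move=> s t _ _; exists (s ++ t) => // h /= /eqP.
  by rewrite map_cat eqseq_cat ?size_map// => /andP[/eqP ? /eqP ?].
have : B --> (1%g : G).
  by apply: aut_cvg => a; exists [:: a] => // h [].
by move=> /(_ V V1)[F _ FV]; exists F => h; exact: FV.
Qed.

Lemma measurable_L0_preimage (U : set G) f : open U -> measurable [set x | U (f x)].
Proof.
move=> oU; rewrite -[X in measurable X]/(L0_fun f @^-1` U) -[_ @^-1` _]setTI.
by apply: L0_measurable => //; exact: borel_open.
Qed.

Lemma measurable_values f F t : measurable [set x | map (f x) F = t].
Proof. exact: (measurable_L0_preimage f (@open_cylinder F t)). Qed.

Lemma measurable_value f a b : measurable [set x | f x a = b].
Proof.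
rewrite (_ : mkset _ = [set x | map (f x) [:: a] = [:: b]]).
  exact: measurable_values.
by apply/seteqP; split=> x /= => [->|[]].
Qed.

(** An open set is a union of cylinders, of which there are countably many. *)
Lemma aut_measurable (u : lebesgueType R -> borelType G) :
  (forall F t, measurable [set x | map (u x : G) F = t]) -> measurable_fun setT u.
Proof.
move=> mu_; apply: borel_measurable => U oU.
rewrite (_ : _ @^-1` _ = [set x | exists p : seq M * seq M,
   (forall h : G, map h p.1 = p.2 -> U h) /\ map (u x : G) p.1 = p.2]).
  apply: (@measurable_exists _ (lebesgueType R) _ (fun p : seq M * seq M => [set x |
    (forall h : G, map h p.1 = p.2 -> U h) /\ map (u x : G) p.1 = p.2])) => p.
  exact: (measurable_constant_and _ (mu_ p.1 p.2)).
apply/seteqP; split=> [x /= Ux|x [p [pU up]]]; last exact: pU.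
have [F FU] : exists F, forall h : G, map h F = F -> U (u x * h : G)%g.
  apply: nbhs1_aut; apply: (@nbhs_mulg G (u x : G)); rewrite mulg1.
  exact: open_nbhs_nbhs.
exists (F, map (u x : G) F); split=> //= h hF.
have -> : h = ((u x : G) * ((u x : G)^-1 * h))%g by rewrite mulVKg.
apply: FU; transitivity (map ((u x : G)^-1)%g (map h F)); first by rewrite -map_comp.
by rewrite hF -map_comp map_id_in // => a _; exact: aut_mulVK.
Qed.

Lemma L0_lift (u : lebesgueType R -> G) :
  (forall F t, measurable [set x | map (u x) F = t]) ->
  exists f : K, \forall x \ae mu, f x = u x.
Proof.
move=> mu_; have mu' : measurable_fun setT (u : lebesgueType R -> borelType G).
  exact: aut_measurable.
exists (L0_class (mfun_Sub (mem_set mu'))); exact: L0_classE.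
Qed.

Definition differ F f g : set (lebesgueType R) :=
  [set x | map (f x) F <> map (g x) F].

Lemma measurable_differ F f g : measurable (differ F f g).
Proof.
rewrite (_ : differ F f g = ~` [set x | exists t, ([set x | map (f x) F = t] `&`
    [set x | map (g x) F = t]) x]).
  apply: measurableC; apply: measurable_exists => t.
  by apply: measurableI; exact: measurable_values.
apply/seteqP; split=> x /=; first by move=> fg [t [ft gt]]; apply: fg; rewrite ft.
by move=> h fg; apply: h; exists (map (f x) F).
Qed.

Lemma differC F f g : differ F f g = differ F g f.
Proof. by apply/seteqP; split=> x /= /nesym. Qed.

Lemma differ_triangle F f g h (e1 e2 : R) : (mu (differ F f g) < e1%:E)%E ->
  (mu (differ F g h) < e2%:E)%E -> (mu (differ F f h) < (e1 + e2)%:E)%E.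
Proof.
move=> fg gh; rewrite EFinD; apply: le_lt_trans (lteD fg gh).
apply: le_trans (measureU2 _ (measurable_differ _ _ _) (measurable_differ _ _ _)).
apply: le_measure; rewrite ?inE; [exact: measurable_differ| |].
  by apply: measurableU; exact: measurable_differ.
move=> x /= nfh; apply: contrapT => /not_orP[/contrapT fg_ /contrapT gh_].
by apply: nfh; rewrite fg_.
Qed.

Lemma map_mulV (u v : G) F : map (u^-1 * v)%g F = F <-> map u F = map v F.
Proof.
rewrite (_ : map (u^-1 * v)%g F = map (u^-1)%g (map v F)); last by rewrite -map_comp.
split=> [vF|<-].
  rewrite -{1}vF -map_comp -[RHS]map_id; apply: eq_map => a; exact: aut_mulKV.
by rewrite -map_comp map_id_in // => a _; exact: aut_mulVK.
Qed.

(** In terms of values on finite tuples, convergence in measure no longer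
    refers to the group law. *)
Lemma nbhs_L0P f (A : set K) : nbhs f A <-> exists F (e : R), (0 < e)%R /\
  forall h, (mu (differ F f h) < e%:E)%E -> A h.
Proof.
split=> [[[V e] /= [[oV V1] e0] VA]|[F [e [e0 FA]]]].
  have [F FV] := nbhs1_aut (open_nbhs_nbhs (conj oV V1)).
  exists F, e; split=> // h hF; apply: VA; rewrite /= /L0ball /=.
  apply: le_lt_trans hF; apply: ae_le_mu01.
  - exact: measurable_L0bad.
  - exact: measurable_differ.
  apply: filterS2 (L0_mulE (f^-1)%g h) (L0_invE f) => x E1 E2 /=.
  by rewrite E1 E2 => nV /map_mulV ?; apply: nV; exact: FV.
exists ([set k : G | map k F = F], e); first split=> //.
  by split; [exact: open_cylinder|exact: map_id].
move=> h /= hF; apply: FA; apply: le_lt_trans hF; apply: ae_le_mu01.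
- exact: measurable_differ.
- by apply: measurable_L0bad; exact: open_cylinder.
by apply: filterS2 (L0_mulE (f^-1)%g h) (L0_invE f) => x E1 E2 nfh /=;
  rewrite E1 E2 => /map_mulV.
Qed.

Section tuples.
Variable n : nat.
Implicit Types (w : seq (letter n)).

Lemma evw_ae (g : 'I_n -> K) w :
  \forall x \ae mu, (evw g w : K) x = evw (fun i => g i x) w.
Proof.
elim: w => [|s w ih]; first exact: L0_oneE.
have sE : \forall x \ae mu, (evl g s : K) x = evl (fun i => g i x) s.
  by rewrite /evl; case: ifP => _; [exact: filterE|exact: L0_invE].
by apply: filterS3 (L0_mulE (evw g w) (evl g s)) ih sE => x /= -> -> ->.
Qed.

Lemma nbhs_tuple (g : {ptws 'I_n -> K}) (O : set {ptws 'I_n -> K}) : nbhs g O ->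
  exists F (e : R), (0 < e)%R /\
  forall g' : 'I_n -> K, (forall i, (mu (differ F (g i) (g' i)) < e%:E)%E) -> O g'.
Proof.
pose B : set_system {ptws 'I_n -> K} :=
  filter_from [set p : seq M * R | (0 < p.2)%R]
  (fun p => [set g' : {ptws 'I_n -> K} | forall i, (mu (differ p.1 (g i) (g' i)) < p.2%:E)%E]).
have FB : Filter B.
  apply: filter_from_filter; first by exists ([::], 1%R); rewrite /= ltr01.
  move=> [s e] [t e'] /= e0 e'0; exists (s ++ t, Num.min e e').
    by rewrite /= lt_min e0.
  move=> g' /= gg'; split=> i; apply: le_lt_trans (lt_le_trans (gg' i) _).
  - apply: le_measure; rewrite ?inE; [exact: measurable_differ|exact: measurable_differ|].
    by move=> x ne /= /eqP; rewrite !map_cat eqseq_cat ?size_map// => /andP[/eqP/ne].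
  - by rewrite lee_fin ge_min lexx.
  - apply: le_measure; rewrite ?inE; [exact: measurable_differ|exact: measurable_differ|].
    by move=> x ne /= /eqP; rewrite !map_cat eqseq_cat ?size_map// => /andP[_ /eqP/ne].
  - by rewrite lee_fin ge_min lexx orbT.
have Bg : B --> g.
  apply/cvg_sup => i W [_ [[C oC <-] Cg CW]].
  have /nbhs_L0P[F [e [e0 FC]]] : nbhs (g i) C by exact: open_nbhs_nbhs.
  by exists (F, e) => // g' /= gg'; apply: CW; apply: FC.
by move=> /Bg[[F e] /= e0 FO]; exists F, e; split=> // g' gg'; exact: FO.
Qed.

End tuples.
End L0_aut.

(** * Totally bounded subgroups are precompact *)

Section limits.
Context (L : language) (M : countType) (S : structure L M).

(** The convergence of the inverses makes the pointwise limit surjective; the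
    rest holds because symbols have finite arity, so that on finitely many
    points the limit agrees with some automorphism of the sequence. *)
Lemma aut_limit (l : nat -> aut S) :
  (forall a, exists b, \forall k \near \oo, l k a = b) ->
  (forall a, exists b, \forall k \near \oo, (l k)^-1%g a = b) ->
  exists h : aut S, forall a, \forall k \near \oo, l k a = h a.
Proof.
move=> /choice[h lh] /choice[h' lh'].
have hK : cancel h h'.
  move=> a; have [k [/= E1 E2]] := filter_ex (filterI (lh a) (lh' (h a))).
  by rewrite -E2 -E1 aut_funK.
have h'K : cancel h' h.
  move=> a; have [k [/= E1 E2]] := filter_ex (filterI (lh (h' a)) (lh' a)).
  by rewrite -E1 -E2 aut_inv_funK.
have near_tuple m (t : 'I_m -> M) : \forall k \near \oo, l k \o t = h \o t.
  have : \forall k \near \oo, forall i : 'I_m, i \in enum 'I_m -> l k (t i) = h (t i).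
    apply: (@filter_allI nat \oo _ (enum 'I_m)
      (fun i => [set k | l k (t i) = h (t i)])) => i _; exact: lh.
  by apply: filterS => k kt; apply/funext => i /=; apply: kt; rewrite mem_enum.
have hrel r (t : 'I_(rel_arity r) -> M) :
    rel_interp S (h \o t) <-> rel_interp S t.
  by have [k /= <-] := filter_ex (near_tuple _ t); exact: aut_rel.
have hfun s (t : 'I_(fun_arity s) -> M) :
    fun_interp S (h \o t) = h (fun_interp S t).
  have [k [/= E1 <-]] := filter_ex (filterI (near_tuple _ t) (lh (fun_interp S t))).
  by rewrite -E1 aut_interp.
by exists (@Aut _ _ S h (Bijective hK h'K) hrel hfun).
Qed.

End limits.

Section compactness.
Context (R : realType) (L : language) (M : countType) (S : structure L M).
Local Notation G := (aut S).
Local Notation K := (L0 R G).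
Local Notation mu := (@mu01 R).
Implicit Types (f h : K) (F : seq M) (a b : M).

Definition initial_segment (k : nat) : seq M := pmap unpickle (iota 0 k).

Lemma mem_initial_segment k a : (pickle a < k)%N -> a \in initial_segment k.
Proof.
move=> ak; rewrite mem_pmap; apply/mapP; exists (pickle a); rewrite ?pickleK//.
by rewrite mem_iota.
Qed.

Lemma sub_differ F F' f h : {subset F <= F'} -> differ F f h `<=` differ F' f h.
Proof.
move=> FF x /=; apply: contra_not => /eq_in_map fh.
by apply/eq_in_map => a /FF; exact: fh.
Qed.

Lemma pickle_bound F : exists k0, forall k, (k0 <= k)%N ->
  forall a, a \in F -> (pickle a < k)%N.
Proof.
exists (\max_(a <- F) (pickle a).+1)%N => k k0 a aF; apply: leq_trans k0.
exact: (@leq_bigmax_seq _ F xpredT (fun a => (pickle a).+1) a).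
Qed.

Definition half_pow (k : nat) : R := ((1 : R) / (2 ^ (k + 1))%:R)%R.

Lemma half_pow_gt0 k : (0 < half_pow k)%R.
Proof. by rewrite /half_pow divr_gt0 ?ltr01 ?ltr0n ?expn_gt0. Qed.

(** As the bounds are summable, almost every point lies in finitely many of the
    exceptional sets, hence the sequence and its inverses are eventually
    constant on each element of [M] there. Inverses have to be controlled as
    well, since the one-sided uniformity of Aut(M) need not be complete. *)
Lemma L0_complete (l : nat -> K) :
  (forall k, (mu (differ (initial_segment k) (l k) (l k.+1)) < (half_pow k)%:E)%E) ->
  (forall k, (mu (differ (initial_segment k) (l k)^-1%g (l k.+1)^-1%g) < (half_pow k)%:E)%E) ->
  exists h, forall F (e : R), (0 < e)%R ->
    \forall k \near \oo, (mu (differ F h (l k)) < e%:E)%E.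
Proof.
move=> dl dlV.
pose Bad k := differ (initial_segment k) (l k) (l k.+1) `|`
              differ (initial_segment k) (l k)^-1%g (l k.+1)^-1%g.
have mBad k : measurable (Bad k) by apply: measurableU; exact: measurable_differ.
have Bad_null : mu (lim_sup_set Bad) = 0%E.
  apply: lim_sup_set_cvg0 => //.
  pose v k : \bar R := ((2%R : R) / (2 ^ (k + 0.+1))%:R)%:E.
  apply: (@le_lt_trans _ _ (\sum_(k <oo) v k)%E).
    apply: lee_nneseries => [k _ _|k _]; first exact: measure_ge0.
    apply: le_trans (measureU2 _ (measurable_differ _ _ _) (measurable_differ _ _ _)) _.
    rewrite (_ : v k = (half_pow k)%:E + (half_pow k)%:E)%E.
      by apply: leeD; apply: ltW; [exact: dl|exact: dlV].
    by rewrite -EFinD /half_pow /v -mulrDl.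
  rewrite (cvg_lim _ (@cvg_geometric_eseries_half R 2%R 0))//.
  by rewrite ltry.
(* Inverses in L0 are pointwise only almost everywhere; a measurable set of
   points where they are is singled out. *)
pose Inv := [set x | forall k a, exists b, l k x a = b /\ L0_fun (l k)^-1%g x b = a].
have mInv : measurable Inv.
  apply: measurable_forall => k; apply: measurable_forall => a.
  apply: measurable_exists => b.
  exact: (measurableI _ _ (measurable_value _ _ _) (measurable_value _ _ _)).
have InvP x : Inv x -> forall k, (L0_fun (l k)^-1%g x) = (l k x)^-1%g.
  move=> Ix k; apply/aut_inj/funext => a.
  have [b' [lb lb']] := Ix k ((l k x)^-1%g a).
  by rewrite aut_mulKV in lb; rewrite {1}lb lb'.
have Inv_ae : \forall x \ae mu, Inv x.
  have : \forall x \ae mu, forall k, (L0_fun (l k)^-1%g x) = (l k x)^-1%g.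
    by apply/ae_foralln => k; exact: L0_invE.
  by apply: filterS => x iE k a; exists (l k x a); rewrite iE aut_mulVK.
pose Good := ~` lim_sup_set Bad `&` Inv.
have mGood : measurable Good.
  apply: measurableI => //; apply: measurableC; apply: bigcap_measurable => // k _.
  exact: bigcup_measurable.
have goodP x : Good x -> exists k0, forall k, (k0 <= k)%N -> ~ Bad k x.
  move=> [gx _]; apply: contrapT => no; apply: gx => k0 _; apply: contrapT => nob.
  by apply: no; exists k0 => k k0k Bk; apply: nob; exists k.
have stable x k0 k : (forall k, (k0 <= k)%N -> ~ Bad k x) -> (k0 <= k)%N ->
    forall a, (pickle a < k)%N -> (l k x) a = (l k.+1 x) a /\
    (L0_fun (l k)^-1%g x) a = (L0_fun (l k.+1)^-1%g x) a.
  move=> nB k0k a ak; have /not_orP[/contrapT/eq_in_map E1 /contrapT/eq_in_map E2] := nB k k0k.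
  by split; [apply: E1|apply: E2]; exact: mem_initial_segment.
have stable2 x k0 k j : (forall k, (k0 <= k)%N -> ~ Bad k x) -> (k0 <= k <= j)%N ->
    forall a, (pickle a < k)%N -> (l j x) a = (l k x) a /\
    (L0_fun (l j)^-1%g x) a = (L0_fun (l k)^-1%g x) a.
  move=> nB /andP[k0k kj] a ak; rewrite -(subnKC kj).
  elim: (j - k)%N => [|i [ih1 ih2]]; first by rewrite addn0.
  have [||E1 E2] := stable x k0 (k + i)%N nB _ a.
  - exact: leq_trans (leq_addr _ _).
  - exact: leq_trans ak (leq_addr _ _).
  by rewrite addnS -E1 -E2.
have lim x : exists h : G, Good x -> forall a, \forall k \near \oo, l k x a = h a.
  have [Gx|nG] := pselect (Good x); last by exists 1%g.
  have [k0 nB] := goodP x Gx; have IE := InvP _ Gx.2.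
  suff [h hx] : exists h : G, forall a, \forall k \near \oo, l k x a = h a by exists h.
  apply: (@aut_limit _ _ _ (fun k => l k x)) => a.
    exists (l (maxn k0 (pickle a).+1) x a); exists (maxn k0 (pickle a).+1) => //= k kk.
    have [||+ _] := stable2 x k0 (maxn k0 (pickle a).+1) k nB _ a; first by rewrite leq_maxl kk.
      by rewrite leq_maxr.
    by [].
  exists ((l (maxn k0 (pickle a).+1) x)^-1%g a); exists (maxn k0 (pickle a).+1) => //= k kk.
  have [||_] := stable2 x k0 (maxn k0 (pickle a).+1) k nB _ a; first by rewrite leq_maxl kk.
    by rewrite leq_maxr.
  by rewrite !IE.
have [lm lmP] := choice lim.
pose u x := if pselect (Good x) then lm x else 1%g.
have uP x : Good x -> forall F, \forall k \near \oo, map (l k x) F = map (u x) F.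
  move=> Gx F; rewrite /u; case: pselect => [Gx'|//].
  have : \forall k \near \oo, forall a, a \in F -> l k x a = lm x a.
    apply: (@filter_allI nat \oo _ F (fun a => [set k | l k x a = lm x a])) => a _.
    exact: lmP.
  by apply: filterS => k kF; apply/eq_in_map => a; exact: kF.
have [h hE] : exists h : K, \forall x \ae mu, h x = u x.
  apply: L0_lift => F t.
  rewrite (_ : mkset _ = (Good `&` [set x | exists k0, forall k, (k0 <= k)%N ->
    map (l k x) F = t]) `|` (~` Good `&` [set x | F = t /\ setT x])).
    apply: measurableU; apply: measurableI => //.
    - apply: measurable_exists => k0; apply: measurable_forall => k.
      apply: (measurable_constant_imply (P := [set x | map (l k x) F = t])) => _.
      exact: measurable_values.
    - exact: measurableC.
    - exact: (measurable_constant_and _ measurableT).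
  apply/seteqP; split=> x /=.
    move=> ut; have [Gx|nG] := pselect (Good x); last first.
      right; split=> //; split=> //; move: ut; rewrite /u.
      by case: pselect => [//|nG']; rewrite map_id.
    by left; split=> //; have [k0 _ kt] := uP x Gx F; exists k0 => k /kt /= ->.
  move=> [[Gx [k0 kt]]|[nG [Ft _]]]; last by rewrite /u; case: pselect => [//|nG']; rewrite map_id.
  have [k1 _ k1u] := uP x Gx F; rewrite -(k1u (maxn k0 k1) (leq_maxr _ _)) /=.
  by rewrite kt ?leq_maxl.
exists h => F e e0.
have [k1 k1F] := pickle_bound F.
have : mu (\bigcup_(j >= k) Bad j) @[k --> \oo] --> 0%E.
  rewrite -Bad_null; apply: lim_sup_set_cvg => //.
  apply: (@le_lt_trans _ _ (mu setT)); last by rewrite mu01T ltry.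
  by apply: le_measure; rewrite ?inE //; exact: bigcup_measurable.
have e0' : (0 < e%:E)%E by rewrite lte_fin.
move=> /(_ _ (open_ereal_lt' e0')) Be.
have nk1 : \forall k \near \oo, (k1 <= k)%N by exists k1.
apply: filterS2 nk1 Be => k kk1 Bk; apply: le_lt_trans Bk; apply: ae_le_mu01.
- exact: measurable_differ.
- exact: bigcup_measurable.
have Good_ae : \forall x \ae mu, ~ lim_sup_set Bad x.
  exists (lim_sup_set Bad); split=> //.
    by apply: bigcap_measurable => // j _; exact: bigcup_measurable.
  by move=> x /= /contrapT.
apply: filterS3 hE Good_ae Inv_ae => x hx gx Ix; apply: contraPP => nB /=; apply.
have Gx : Good x by split.
have nBk j : (k <= j)%N -> ~ Bad j x by move=> kj Bj; apply: nB; exists j.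
have [k2 _ k2u] := uP x Gx F; rewrite hx -(k2u (maxn k k2) (leq_maxr _ _)) /=.
apply/eq_in_map => a aF.
have [|+ _] := stable2 x k k (maxn k k2) nBk _ a (k1F k kk1 a aF).
  by rewrite leqnn leq_maxl.
by move=> ->.
Qed.
End compactness.
Arguments half_pow R k : clear implicits.
Arguments initial_segment M k : clear implicits.

Lemma ultra_cover (T : Type) (I : eqType) (U : set_system T) (s : seq I)
    (P : I -> set T) (A : set T) : UltraFilter U -> U A ->
  (forall x, A x -> exists2 i, i \in s & P i x) -> exists i, U (P i).
Proof.
move=> UU; elim: s A => [|i s ih] A UA cov.
  by have [x /cov[]] := filter_ex UA.
have [UP|UnP] := in_ultra_setVsetC (P i) UU; first by exists i.
apply: (ih (A `&` ~` P i)); first exact: filterI.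
move=> x [/cov[j]]; rewrite inE => /predU1P[->//|js Pj _].
by exists j.
Qed.

Section compactness.
Context (R : realType) (L : language) (M : countType) (S : structure L M).
Local Notation G := (aut S).
Local Notation K := (L0 R G).
Local Notation mu := (@mu01 R).
Implicit Types (h : K) (F : seq M) (a b : M).

Lemma half_pow_lt (e : R) : (0 < e)%R -> \forall k \near \oo, (half_pow R k < e)%R.
Proof.
move=> e0; have := near_infty_natSinv_lt (PosNum e0); apply: filterS => k /=.
apply: le_lt_trans; rewrite /half_pow div1r lef_pV2 ?posrE ?ltr0n ?expn_gt0//.
rewrite ler_nat addn1; apply: ltnW; exact: ltn_expl.
Qed.

Section tuple.
Variables (n : nat) (f : 'I_n -> K).

(** Total boundedness of the generated subgroup, the finite nets being given by
    words. *)
Definition totally_bounded := forall F (e : R), (0 < e)%R ->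
  exists W : seq (seq (letter n)), forall w, exists2 v, v \in W &
    (mu (differ F (evw f v) (evw f w)) < e%:E)%E.

Lemma closure_generated_inv h : closure (generated_subgroup f) h ->
  closure (generated_subgroup f) h^-1%g.
Proof.
move=> fh A /(@invg_continuous K h) /fh [z []]; rewrite generated_subgroupE.
by move=> [w _ <-] Aw; exists (evw f w)^-1%g; split=> //; exists (winv w); rewrite ?evw_winv.
Qed.

Lemma closure_cover : totally_bounded -> forall F (e : R), (0 < e)%R ->
  exists W : seq (seq (letter n)), forall h, closure (generated_subgroup f) h ->
   exists2 v, v \in W & (mu (differ F (evw f v) h) < e%:E)%E.
Proof.
move=> tb F e e0; have e20 : (0 < e / 2)%R by rewrite divr_gt0.
have [W Wtb] := tb F _ e20; exists W => h fh.
have /fh[z []] : nbhs h [set g | (mu (differ F h g) < (e / 2)%:E)%E].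
  by apply/nbhs_L0P; exists F, (e / 2)%R.
rewrite generated_subgroupE => -[w _ <-] /= hw; have [v vW vw] := Wtb w.
exists v => //; rewrite [e]splitr; apply: differ_triangle vw _.
by rewrite differC.
Qed.

(** An ultrafilter on the closure concentrates, for each radius, near one
    element, and by inversion the same holds for the inverses; the centres can
    then be chosen as a sequence to which [L0_complete] applies. *)
Lemma totally_bounded_precompact : totally_bounded ->
  precompact_set (generated_subgroup f).
Proof.
move=> tb; rewrite /precompact_set compact_ultra => U UU UB.
have UF : ProperFilter U by exact: ultra_proper.
have cov k : exists p : seq (letter n) * seq (letter n), U [set h |
   (mu (differ (initial_segment M k) (evw f p.1) h) < (half_pow R k / 2)%:E)%E /\
   (mu (differ (initial_segment M k) (evw f p.2) h^-1%g) < (half_pow R k / 2)%:E)%E].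
  have k0 : (0 < half_pow R k / 2)%R by rewrite divr_gt0 ?half_pow_gt0.
  have [W WB] := closure_cover tb (initial_segment M k) k0.
  have [u Uu] := ultra_cover UU UB WB.
  have [v Uv] : exists v, U [set h |
      (mu (differ (initial_segment M k) (evw f v) h^-1%g) < (half_pow R k / 2)%:E)%E].
    apply: (ultra_cover (s := W) UU UB) => h /closure_generated_inv.
    exact: WB.
  by exists (u, v); exact: filterI.
have /choice[p Up] := cov.
pose T k := [set h |
   (mu (differ (initial_segment M k) (evw f (p k).1) h) < (half_pow R k / 2)%:E)%E /\
   (mu (differ (initial_segment M k) (evw f (p k).2) h^-1%g) < (half_pow R k / 2)%:E)%E].
have /choice[l lT] k : exists h, forall j, (j <= k)%N -> T j h.
  have /filter_ex[h hT] : U [set h | forall j, j \in iota 0 k.+1 -> T j h].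
    by apply: filter_allI => j _; exact: Up.
  by exists h => j jk; apply: hT; rewrite mem_iota.
have close k g h : T k g -> T k h ->
    (mu (differ (initial_segment M k) g h) < (half_pow R k)%:E)%E /\
    (mu (differ (initial_segment M k) g^-1%g h^-1%g) < (half_pow R k)%:E)%E.
  move=> [g1 g2] [h1 h2]; rewrite [half_pow R k]splitr.
  split; first by apply: differ_triangle h1; rewrite differC.
  by apply: differ_triangle h2; rewrite differC.
have [||h lh] := @L0_complete R L M S l.
- by move=> k; case: (close k _ _ (lT k k (leqnn k)) (lT k.+1 k (leqnSn k))).
- by move=> k; case: (close k _ _ (lT k k (leqnn k)) (lT k.+1 k (leqnSn k))).
have Uh : U --> h.
  move=> A /nbhs_L0P[F [e [e0 FA]]].
  have e20 : (0 < e / 2)%R by rewrite divr_gt0.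
  have [k0 k0F] := pickle_bound F.
  have nk0 : \forall k \near \oo, (k0 <= k)%N by exists k0.
  have [k [[/= hk ek] kk0]] := filter_ex (filterI (filterI (lh F _ e20) (half_pow_lt e20)) nk0).
  apply: filterS (Up k) => g gT; apply: FA; rewrite [e]splitr.
  apply: differ_triangle hk _.
  have [lkg _] := close k _ _ (lT k k (leqnn k)) gT.
  apply: (@lt_trans _ _ (half_pow R k)%:E); last by rewrite lte_fin.
  apply: le_lt_trans lkg; apply: le_measure; rewrite ?inE; [exact: measurable_differ|exact: measurable_differ|].
  apply: sub_differ => a aF; apply: mem_initial_segment; exact: k0F aF.
exists h; split=> //.
have cl := @closed_closure _ (generated_subgroup f).
apply: cl => A /Uh UA; have [z [? ?]] := filter_ex (filterI UA UB).
by exists z.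
Qed.

End tuple.
End compactness.

(** * Finite orbits and total boundedness *)

Lemma finite_range_map (T : Type) (I : eqType) (U : choiceType)
    (B : I -> T -> U) (s : seq I) :
  (forall i, i \in s -> finite_set (range (B i))) ->
  finite_set (range (fun x => [seq B i x | i <- s])).
Proof.
elim: s => [|i s ih] fB.
  by apply: (sub_finite_set _ (finite_set1 [::])) => _ [x _ <-].
have fi := fB i (mem_head _ _); have {}ih : finite_set (range (fun x => [seq B i x | i <- s])).
  by apply: ih => j js; apply: fB; rewrite inE js orbT.
apply: (sub_finite_set _ (finite_image (fun p => p.1 :: p.2) (finite_setX fi ih))).
by move=> _ [x _ <-]; exists (B i x, [seq B i x | i <- s]).
Qed.

Lemma finite_range_transversal (T : eqType) (U : choiceType) (B : T -> U) (x0 : T) :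
  finite_set (range B) ->
  exists W : seq T, forall x, exists2 y, y \in W & B y = B x.
Proof.
move=> /finite_seqP[s sE].
have /choice[pre preP] u : exists y, range B u -> B y = u.
  have [[y _ <-]|nu] := pselect (range B u); first by exists y.
  by exists x0.
exists (map pre s) => x; have Bx : range B (B x) by exists x.
exists (pre (B x)); last exact: preP.
by apply: map_f; move: Bx; rewrite sE.
Qed.

Section orbits.
Context (R : realType) (L : language) (M : countType) (S : structure L M).
Local Notation G := (aut S).
Local Notation K := (L0 R G).
Local Notation mu := (@mu01 R).
Variable n : nat.
Implicit Types (F X : seq M) (a b : M) (w v : seq (letter n)).

Definition invariant_seq (h : 'I_n -> G) X :=
  forall s y, y \in X -> evl h s y \in X.

Lemma finite_orbit_seq (h : 'I_n -> G) F : (forall b, finite_orbit h b) ->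
  exists2 X, {subset F <= X} & invariant_seq h X.
Proof.
move=> fo; elim: F => [|a F [X FX hX]]; first by exists [::].
have [Y Ya hY] := fo a; exists (Y ++ X).
  by move=> b; rewrite inE mem_cat => /predU1P[->|/FX ->]; rewrite ?Ya ?orbT.
by move=> s y; rewrite !mem_cat => /orP[/(hY s)|/(hX s)] ->; rewrite ?orbT.
Qed.

Lemma evw_invariant (h : 'I_n -> G) X w y : invariant_seq h X -> y \in X ->
  evw h w y \in X.
Proof. by move=> hX; elim: w y => // s w ih y /(hX s) /ih; rewrite evw_consE. Qed.

Lemma evw_agree (h h' : 'I_n -> G) X w y : invariant_seq h X ->
  (forall i, map (h i) X = map (h' i) X) -> y \in X -> evw h w y = evw h' w y.
Proof.
move=> hX hh'; elim: w y => // s w ih y yX; rewrite !evw_consE.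
have -> : evl h' s y = evl h s y; last by apply: ih; exact: hX.
have hE i z : z \in X -> h i z = h' i z by have /eq_in_map := hh' i; apply.
have := hX s y yX; case: s => i [] sX; first by rewrite /evl /= hE.
apply: (bij_inj (aut_bij (h' i))); by rewrite evl_falseKV -hE // evl_falseKV.
Qed.

Definition infinite_orbit_set (g : 'I_n -> K) b : set (lebesgueType R) :=
  [set x | ~ finite_orbit (fun i => g i x) b].

Lemma measurable_invariant (g : 'I_n -> K) X :
  measurable [set x | invariant_seq (fun i => g i x) X].
Proof.
apply: measurable_forall => s; apply: measurable_forall => y.
apply: (measurable_constant_imply (P := [set x | evl (fun i => g i x) s y \in X])) => _.
rewrite (_ : mkset _ = [set x | exists z, z \in X /\
    [set x | evl (fun i => g i x) s y = z] x]); last first.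
  apply/seteqP; split=> x /=; last by move=> [z [zX ->]].
  by exists (evl (fun i => g i x) s y).
apply: measurable_exists => z; apply: measurable_constant_and.
case: s => i []; first exact: measurable_value.
rewrite (_ : mkset _ = [set x | g i x z = y]); first exact: measurable_value.
apply/seteqP; split=> x xE.
  have <- : evl (fun i => g i x) (i, false) y = z by exact: xE.
  exact: (evl_falseKV (fun i => g i x)).
have <- : g i x z = y by exact: xE.
exact: (evl_falseK (fun i => g i x)).
Qed.

Lemma measurable_infinite_orbit_set g b : measurable (infinite_orbit_set g b).
Proof.
rewrite (_ : infinite_orbit_set g b = ~` [set x | exists X, b \in X /\
    [set x | invariant_seq (fun i => g i x) X] x]).
  apply: measurableC; apply: measurable_exists => X; apply: measurable_constant_and.
  exact: measurable_invariant.
apply/seteqP; split=> x /=; first by move=> no [X [bX hX]]; apply: no; exists X.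
by move=> no [X bX hX]; apply: no; exists X.
Qed.

(** Record a finite invariant set containing [F] together with the action of
    the generators on it. Countably many records occur, so finitely many of
    them cover all but a small set; and within one record a word acts on [F] in
    one of finitely many ways. *)
Lemma finite_orbits_totally_bounded (g : 'I_n -> K) :
  (forall b, mu (infinite_orbit_set g b) = 0%E) -> totally_bounded g.
Proof.
move=> g0 F e e0.
pose val (x : lebesgueType R) : 'I_n -> G := fun i => g i x.
pose Q (t : seq M * {ffun 'I_n -> seq M}) := [set x |
  {subset F <= t.1} /\ ([set x | invariant_seq (val x) t.1] `&`
    [set x | forall i, map (val x i) t.1 = t.2 i]) x].
have mQ t : measurable (Q t).
  apply: measurable_constant_and; apply: measurableI; first exact: measurable_invariant.
  by apply: measurable_forall => i; exact: measurable_values.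
have Qfull : mu [set x | exists t, Q t x] = 1%E.
  apply/eqP; rewrite eq_le; apply/andP; split.
    by rewrite -(mu01T R); apply: le_measure; rewrite ?inE//; exact: measurable_exists.
  rewrite -(mu01T R); apply: ae_le_mu01 => //; first exact: measurable_exists.
  have : \forall x \ae mu, forall k, (if unpickle k is Some b then
      ~ infinite_orbit_set g b x else True).
    apply/ae_foralln => k; case: unpickle => [b|]; last exact: filterE.
    exists (infinite_orbit_set g b); split; [exact: measurable_infinite_orbit_set|exact: g0|].
    by move=> x /= /contrapT.
  apply: filterS => x fx _; have fo b : finite_orbit (val x) b.
    by have := fx (pickle b); rewrite pickleK => /contrapT.
  have [X FX hX] := finite_orbit_seq F fo.
  exists (X, [ffun i => map (val x i) X]); split=> //; split=> // i /=.
  by rewrite ffunE.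
have [r] : exists r, ((1 - e)%:E < mu [set x | exists2 t, (pickle t < r)%N & Q t x])%E.
  apply: (approx_from_below mQ); apply: (@lt_le_trans _ _ 1%E).
    by rewrite lte_fin ltrBlDr ltrDl.
  by rewrite -Qfull.
set C := mkset _ => Cr.
have mC : measurable C.
  rewrite (_ : C = [set x | exists t, (pickle t < r)%N /\ Q t x]).
    by apply: measurable_exists => t; exact: measurable_constant_and.
  by apply/seteqP; split=> x [t]; [exists t|case; exists t].
have muC : (mu (~` C) < e%:E)%E.
  have : mu setT = (mu C + mu (~` C))%E.
    rewrite -measureU ?setUv ?setICr//; exact: measurableC.
  rewrite mu01T => CC; have fC : mu C \is a fin_num.
    rewrite ge0_fin_numE ?measure_ge0//; apply: le_lt_trans (ltry (1%R : R)).
    by rewrite -(mu01T R); apply: le_measure; rewrite ?inE.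
  have -> : mu (~` C) = (1 - mu C)%E by rewrite CC addeAC subee ?add0e.
  move: Cr; rewrite -(fineK fC) lte_fin -EFinB lte_fin => Cr.
  by rewrite ltrBlDl -ltrBlDr.
(* Over the cell Q t, a word acts on F as it does at the chosen point xs t. *)
have /choice[xs xsP] t : exists x, (exists y, Q t y) -> Q t x.
  have [[y Qy]|no] := pselect (exists y, Q t y); first by exists y.
  by exists point.
pose beh k w : seq M := if unpickle k is Some t then
  if pselect (exists y, Q t y) then map (evw (val (xs t)) w) F else [::] else [::].
have fbeh k : finite_set (range (beh k)).
  rewrite /beh; case: unpickle => [t|]; last first.
    by apply: (sub_finite_set _ (finite_set1 [::])) => _ [x _ <-].
  case: pselect => [ex|no] /=; last first.
    by apply: (sub_finite_set _ (finite_set1 [::])) => _ [x _ <-].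
  have [Ft [inv _]] := xsP t ex.
  apply: (finite_range_map (B := fun a w => evw (val (xs t)) w a)) => a /Ft aX.
  apply: (sub_finite_set _ (finite_seq t.1)) => _ [w _ <-].
  exact: evw_invariant.
have [W WP] : exists W : seq (seq (letter n)), forall w, exists2 v, v \in W &
    [seq beh k v | k <- iota 0 r] = [seq beh k w | k <- iota 0 r].
  apply: (finite_range_transversal (B := fun w => [seq beh k w | k <- iota 0 r])).
    exact: [::].
  by apply: finite_range_map => k _; exact: fbeh.
exists W => w; have [v vW /eq_in_map vw] := WP w; exists v => //.
apply: le_lt_trans muC; apply: ae_le_mu01.
- exact: measurable_differ.
- exact: measurableC.
apply: filterS2 (evw_ae g v) (evw_ae g w) => x Ev Ew; rewrite /differ /= Ev Ew.
move=> ne [t tr Qx]; apply: ne.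
have := vw (pickle t); rewrite mem_iota /= add0n => /(_ tr).
rewrite /beh pickleK; case: pselect => [ex|[]] /=; last by exists x.
have [Ft [inv xst]] := xsP t ex; have [_ [_ xt]] := Qx.
have act u a : a \in F -> evw (val (xs t)) u a = evw (val x) u a.
  move=> /Ft aX; apply: (evw_agree _ inv) => // i.
  by rewrite (xst i) -(xt i).
move=> /eq_in_map E; apply/eq_in_map => a aF.
by rewrite -/(val x) -!act // E.
Qed.

End orbits.

(** * Topological similarity *)

Section similarity.
Context (K : topologicalGroupType) (n : nat) (f g : 'I_n -> K).

Lemma in_generated w : evw f w \in generated_subgroup f.
Proof. by rewrite inE generated_subgroupE; exists w. Qed.

Variable phi : K -> K.
Hypothesis iso : bicontinuous_isomorphism (generated_subgroup f) (generated_subgroup g) phi.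
Hypothesis phi_fg : forall i, phi (f i) = g i.

Lemma iso_evw w : phi (evw f w) = evw g w.
Proof.
have [_ phiM _ _] := iso.
have phi1 : phi 1%g = 1%g.
  have := phiM 1%g 1%g (in_generated [::]) (in_generated [::]).
  rewrite mulg1 => /(congr1 (fun x => (phi 1)^-1 * x)%g).
  by rewrite mulVg mulKg.
elim: w => //= s w ih.
have sE : evl f s = evw f [:: s] by rewrite /= mul1g.
rewrite phiM; [|exact: in_generated|rewrite sE; exact: in_generated].
rewrite ih; congr (_ * _)%g; case: s sE => i [] sE; first exact: phi_fg.
apply: (mulgI (g i)); rewrite /evl /= mulgV -phi_fg.
have fE : f i = evw f [:: (i, true)] by rewrite /= mul1g.
rewrite -phiM ?mulgV //; first by rewrite fE; exact: in_generated.
by rewrite -[(f i)^-1%g]/(evl f (i, false)) sE; exact: in_generated.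
Qed.

Lemma iso_nbhs V : nbhs (1%g : K) V ->
  exists2 V', nbhs (1%g : K) V' & forall w, V' (evw f w) -> V (evw g w).
Proof.
move=> V1; have [_ _ /subspace_continuousP cphi _] := iso.
have Vphi : nbhs (phi (evw f [::])) V by rewrite iso_evw.
exists [set y | generated_subgroup f y -> V (phi y)].
  exact: (cphi (evw f [::]) (set_mem (in_generated [::])) V Vphi).
by move=> w /(_ (set_mem (in_generated w))) /=; rewrite iso_evw.
Qed.

Lemma iso_nbhs_inv V : nbhs (1%g : K) V ->
  exists2 V', nbhs (1%g : K) V' & forall w, V' (evw g w) -> V (evw f w).
Proof.
move=> V1; have [_ _ _ [psi phiK /subspace_continuousP cpsi]] := iso.
have psi_evw w : psi (evw g w) = evw f w.
  by rewrite -iso_evw phiK // in_generated.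
have gen w : generated_subgroup g (evw g w) by rewrite generated_subgroupE; exists w.
have Vpsi : nbhs (psi (evw g [::])) V by rewrite psi_evw.
exists [set y | generated_subgroup g y -> V (psi y)].
  exact: (cpsi (evw g [::]) (gen [::]) V Vpsi).
by move=> w /(_ (gen w)) /=; rewrite psi_evw.
Qed.

End similarity.

Section L0_similarity.
Context (R : realType) (L : language) (M : countType) (S : structure L M).
Local Notation G := (aut S).
Local Notation K := (L0 R G).
Local Notation mu := (@mu01 R).
Variable n : nat.
Implicit Types (F X : seq M) (a b : M) (w v : seq (letter n)).

Lemma differ_mulV F (f h : K) : mu (differ F 1%g (f^-1 * h)%g) = mu (differ F f h).
Proof.
have E : \forall x \ae mu, map (L0_fun (1%g : K) x) F <> map (L0_fun (f^-1 * h)%g x) F <->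
    map (f x) F <> map (h x) F.
  apply: filterS3 (L0_mulE f^-1%g h) (L0_invE f) (L0_oneE R G) => x E1 E2 E3.
  rewrite E1 E2 E3 map_id; split; apply: contra_not => fh.
    by apply/esym/map_mulV.
  by apply/map_mulV.
apply/eqP; rewrite eq_le; apply/andP; split; apply: ae_le_mu01;
  try exact: measurable_differ.
  by apply: filterS E => x [].
by apply: filterS E => x [].
Qed.

(** Two words are close at a tuple when their quotient is close to 1 there, and
    closeness to 1 is preserved by similarity. *)
Lemma totally_bounded_similar (f g : 'I_n -> K) :
  topological_similarity_class f g -> totally_bounded g -> totally_bounded f.
Proof.
move=> [phi iso fg] tb F e e0.
have N : nbhs (1%g : K) [set h | (mu (differ F 1%g h) < e%:E)%E].
  by apply/nbhs_L0P; exists F, e.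
have [V' + V'f] := iso_nbhs_inv iso fg N.
move=> /nbhs_L0P[F' [e' [e'0 FV']]]; have [W WP] := tb F' e' e'0.
exists W => w; have [v vW vw] := WP w; exists v => //.
have := V'f (w ++ winv v); rewrite !evw_cat !evw_winv /= differ_mulV; apply.
by apply: FV'; rewrite differ_mulV.
Qed.

Lemma nbhs_moves (h : K) b (e : R) : (e%:E < mu (differ [:: b] 1%g h))%E ->
  nbhs h [set h' : K | (e%:E < mu (differ [:: b] 1%g h'))%E].
Proof.
move=> eh.
have fin : mu (differ [:: b] 1%g h) \is a fin_num.
  rewrite ge0_fin_numE ?measure_ge0//; apply: le_lt_trans (ltry (1%R : R)).
  by rewrite -(mu01T R); apply: le_measure; rewrite ?inE//; exact: measurable_differ.
move: eh; rewrite -(fineK fin) lte_fin; set m := fine _ => em.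
have d0 : (0 < (m - e) / 2)%R by rewrite divr_gt0 // subr_gt0.
apply/nbhs_L0P; exists [:: b], ((m - e) / 2)%R; split=> // h' hh' /=.
rewrite ltNge; apply/negP => h'e.
have : (mu (differ [:: b] 1%g h) < (e + (m - e) / 2 + (m - e) / 2)%:E)%E.
  apply: (@differ_triangle _ _ _ _ _ _ h'); last by rewrite differC.
  by apply: le_lt_trans h'e _; rewrite lte_fin ltrDl.
rewrite -(fineK fin) -/m lte_fin -addrA -splitr addrC subrK.
by rewrite ltxx.
Qed.

Lemma nbhs_evl (K' : topologicalGroupType) (g : {ptws 'I_n -> K'}) s V :
  nbhs (evl g s : K') V -> nbhs g [set g' : {ptws 'I_n -> K'} | V (evl g' s)].
Proof.
have cp i (B : set K') : nbhs (g i) B -> nbhs g [set g' : {ptws 'I_n -> K'} | B (g' i)].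
  exact: (@proj_continuous _ (fun=> K') i g).
case: s => i []; first exact: cp.
by move=> /(@invg_continuous K' (g i)); exact: cp.
Qed.

Lemma nbhs_evw (K' : topologicalGroupType) (g : {ptws 'I_n -> K'}) w V :
  nbhs (evw g w : K') V -> nbhs g [set g' : {ptws 'I_n -> K'} | V (evw g' w)].
Proof.
elim: w V => [|s w ih] V VE.
  by apply: filterE => g' /=; exact: nbhs_singleton VE.
have [[A B] /= [/ih gA /nbhs_evl gB] AB] := @mulg_continuous K' (evw g w, evl g s) V VE.
by apply: filterS2 gA gB => g' /= Ag Bg; exact: (AB (evw g' w, evl g' s)).
Qed.

(** * The similarity class is meager *)

Section modification.
Hypothesis finite_acl : forall A : set M, finite_set A -> finite_set (acl S A).
Hypothesis n_gt0 : (0 < n)%N.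
Variable (f : 'I_n -> K).
Hypothesis nondiscrete : ~ discrete_set (generated_subgroup f).

(** The change takes place inside the cells where the restriction of [g] to a
    finite algebraically closed set containing [F] is constant, and does not
    affect that restriction. *)
Lemma modification (g : 'I_n -> K) b (e d : R) F V : nbhs (1%g : K) V -> (0 < e)%R ->
  (e%:E < mu (infinite_orbit_set g b))%E -> (0 < d)%R ->
  exists2 g' : 'I_n -> K, forall i, (mu (differ F (g i) (g' i)) < d%:E)%E &
    exists2 w, V (evw f w) & (e%:E < mu (differ [:: b] 1%g (evw g' w)))%E.
Proof.
move=> V1 e0 eE d0.
have fF : finite_set (acl S [set` F]) by apply: finite_acl; exact: finite_seq.
have /finite_seqP[A AE] := fF.
have clA : acl_closed S [set` A] by rewrite -AE; exact: acl_closed_acl.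
have FA : {subset F <= A}.
  by move=> a aF; have : [set` A] a by rewrite -AE; exact: sub_acl.
pose val (x : lebesgueType R) : 'I_n -> G := fun i => g i x.
pose tp (h : 'I_n -> G) : {ffun 'I_n -> seq M} := [ffun i => map (h i) A].
have tpE h h' : (tp h = tp h') <-> (forall i, map (h i) A = map (h' i) A).
  split=> [/ffunP E i|E]; first by have := E i; rewrite !ffunE.
  by apply/ffunP => i; rewrite !ffunE.
pose Tp t := [set x | tp (val x) = t].
have mTp t : measurable (Tp t).
  rewrite (_ : Tp t = [set x | forall i, map (g i x) A = t i]).
    by apply: measurable_forall => i; exact: measurable_values.
  apply/seteqP; split=> x; rewrite /Tp /=.
    by move=> <- i; rewrite ffunE.
  by move=> E; apply/ffunP => i; rewrite ffunE; exact: E.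
pose P t := Tp t `&` infinite_orbit_set g b.
have mP t : measurable (P t).
  by apply: measurableI; [exact: mTp|exact: measurable_infinite_orbit_set].
have [r] : exists r, (e%:E < mu [set x | exists2 t, (pickle t < r)%N & P t x])%E.
  apply: (approx_from_below mP); rewrite (_ : mkset _ = infinite_orbit_set g b)//.
  by apply/seteqP; split=> [x [t []]//|x Ex]; exists (tp (val x)).
set C := mkset _ => Cr.
have mC : measurable C.
  rewrite (_ : C = [set x | exists t, (pickle t < r)%N /\ P t x]).
    by apply: measurable_exists => t; exact: measurable_constant_and.
  by apply/seteqP; split=> x [t]; [exists t|case; exists t].
have [x0 Ex0] : exists x0, infinite_orbit_set g b x0.
  apply: contrapT => no; move: eE; rewrite (_ : infinite_orbit_set g b = set0).
    by rewrite measure0 lte_fin ltNge (ltW e0).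
  by apply/seteqP; split=> x // Ex; apply: no; exists x.
(* A representative of each cell; the default value matters as [moving_word]
   asks for infinite orbits at all indices below r. *)
have /choice[xs xsP] k : exists x, infinite_orbit_set g b x /\
    forall t, pickle t = k -> (exists y, P t y) -> P t x.
  have [[t [tk [y Py]]]|no] := pselect (exists t, pickle t = k /\ exists y, P t y).
    exists y; split=> [|t']; first by case: Py.
    by rewrite -tk => /(pcan_inj pickleK) ->.
  by exists x0; split=> // t tk Pt; case: no; exists t.
pose Ds k (s : letter n) : set M :=
  if s.2 then [set` A] else val (xs k) s.1 @` [set` A].
have [k _|w Vw wP] := @moving_word _ _ _ finite_acl n n_gt0 K f V r
  (fun k => val (xs k)) Ds b nondiscrete V1.
  split; last by have [] := xsP k.
  have fA : finite_set [set` A] by exact: finite_seq.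
  case=> i []; split; rewrite /Ds /=.
  - exact: fA.
  - exact: clA.
  - by [].
  - exact: finite_image.
  - exact: acl_closed_image.
  apply/seteqP; split=> [y Ay|_ [_ [y Ay <-] <-]].
    by exists (val (xs k) i y); [exists y|exact: evl_falseK].
  by have := evl_falseK (val (xs k)) i y; rewrite /evl /= => ->.
(* The new values, one for each type that allows the word to move b. *)
have /choice[sel selP] (t : {ffun 'I_n -> seq M}) : exists ho : option ('I_n -> G),
    if ho is Some h then tp h = t /\ evw h w b <> b
    else forall h, tp h = t -> evw h w b = b.
  have [[h hP]|no] := pselect (exists h, tp h = t /\ evw h w b <> b).
    by exists (Some h).
  exists None => h ht; apply: contrapT => hb; apply: no.
  by exists h.
pose u i x : G := if sel (tp (val x)) is Some h then h i else g i x.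
have /choice[g' g'P] i : exists h : K, \forall x \ae mu, h x = u i x.
  apply: L0_lift => F' t.
  rewrite (_ : mkset _ = [set x | exists p, (Tp p `&` [set x |
    map ((if sel p is Some h then h i else g i x) : G) F' = t]) x]).
    apply: measurable_exists => p; apply: measurableI; first exact: mTp.
    case: (sel p) => [h|]; last exact: measurable_values.
    have [E|nE] := pselect (map (h i) F' = t).
      by rewrite (_ : mkset _ = setT)//; apply/seteqP; split=> x.
    by rewrite (_ : mkset _ = set0)//; apply/seteqP; split=> x // /nE.
  apply/seteqP; split=> x; first by move=> ux; exists (tp (val x)); split; [|exact: ux].
  by move=> [p [<- ux]]; exact: ux.
exists g'.
  move=> i; apply: (@le_lt_trans _ _ (mu set0)); last by rewrite measure0 lte_fin.
  apply: ae_le_mu01 => //; first exact: measurable_differ.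
  apply: filterS (g'P i) => x g'x; rewrite /differ /= g'x; apply.
  apply/eq_in_map => a /FA aA; rewrite /u; case E : (sel _) => [h|//].
  have := selP (tp (val x)); rewrite E => -[/tpE/(_ i)/eq_in_map/(_ a aA) -> _].
  by [].
exists w => //; apply: lt_le_trans Cr _; apply: ae_le_mu01 => //.
  exact: measurable_differ.
have g'all : \forall x \ae mu, forall i, i \in enum 'I_n -> g' i x = u i x.
  by apply: filter_allI => i _; exact: g'P.
apply: filterS3 g'all (evw_ae g' w) (L0_oneE R G) => x g'x E1 E2 [t tr Px] /= [].
rewrite E1 E2 /=.
have -> : (fun i => g' i x) = (fun i => u i x).
  by apply/funext => i; apply: g'x; rewrite mem_enum.
have [_ /(_ t erefl (ex_intro _ x Px))[xst _]] := xsP (pickle t).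
have [h hD hb] := wP _ tr.
have ht : tp h = t.
  rewrite -xst; apply/tpE => i; apply/eq_in_map => a aA.
  exact: (hD (i, true) a aA).
have := selP t; rewrite /u; move: Px => [<- _] in ht *; case: (sel _) => [h' [_ h'b] /nesym//|].
by move=> /(_ h ht).
Qed.

(** If [f] does not generate a precompact subgroup, then countably many of these
    sets cover its similarity class: the first condition comes from continuity
    at 1 of the isomorphism, the second from [finite_orbits_totally_bounded]. *)
Definition slow_tuples (V : set K) b (e : R) : set {ptws 'I_n -> K} :=
  [set g | (forall w, V (evw f w) -> (mu (differ [:: b] 1%g (evw g w)) <= e%:E)%E) /\
     (e%:E < mu (infinite_orbit_set g b))%E].

Lemma slow_tuples_nowhere_dense V b e : nbhs (1%g : K) V -> (0 < e)%R ->
  nowhere_dense (slow_tuples V b e).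
Proof.
move=> V1 e0; apply/seteqP; split=> // g0 g0B.
have [g [[_ eE] gB]] : slow_tuples V b e `&` (closure (slow_tuples V b e))° !=set0.
  exact: (nbhs_singleton g0B) _ (nbhs_interior g0B).
have [F [d [d0 Fd]]] := nbhs_tuple gB.
have [g' gg' [w Vw ew]] := modification F V1 e0 eE d0.
have [h [[hV _] /= eh]] := Fd g' gg' _ (nbhs_evw (nbhs_moves ew)).
by move: (hV w Vw); rewrite leNgt eh.
Qed.

End modification.
End L0_similarity.

Theorem theorem4p17 (R : realType) (L : language) (M : countType)
    (S : structure L M) (n : nat) :
  locally_finite S ->
  (forall A : set M, finite_set A -> finite_set (acl S A)) ->
  (1 <= n)%N ->
  (exists h : 'I_n -> aut S, dense (diagonal_conj_class h)) ->
  forall f : 'I_n -> L0 R (aut S),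
    precompact_set (generated_subgroup f) \/
    discrete_set (generated_subgroup f) \/
    meager (topological_similarity_class f).
Proof.
move=> _ finite_acl n_gt0 _ f.
have [?|nonprecompact] := pselect (precompact_set (generated_subgroup f)); first by left.
have [?|nondiscrete] := pselect (discrete_set (generated_subgroup f)); first by right; left.
right; right; pose K := L0 R (aut S).
pose eps (m : nat) : R := (m.+1%:R^-1)%R.
have eps0 m : (0 < eps m)%R by rewrite invr_gt0 ltr0n.
pose ball (F : seq M) (m : nat) : set K := [set h | (mu01 (differ F 1%g h) < (eps m)%:E)%E].
have ball1 F m : nbhs (1%g : K) (ball F m) by apply/nbhs_L0P; exists F, (eps m).
pose N k : set {ptws 'I_n -> K} := if unpickle k is Some p then
  let: (b, m, (F, j)) := p : M * nat * (seq M * nat) in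
  slow_tuples f (ball F j) b (eps m) else set0.
exists N => [k|g fg].
  rewrite /N; case: unpickle => [[[b m] [F j]]|].
    exact: slow_tuples_nowhere_dense.
  by rewrite /nowhere_dense closure0 interior0.
have [b [m Em]] : exists b m, ((eps m)%:E < mu01 (infinite_orbit_set g b))%E.
  apply: contrapT => no; apply: nonprecompact.
  apply: totally_bounded_precompact; apply: totally_bounded_similar fg _.
  apply: finite_orbits_totally_bounded => b; apply/eqP; rewrite eq_le measure_ge0 andbT.
  apply/lee_addgt0Pr => e e0; rewrite add0e.
  have [m me] := filter_ex (near_infty_natSinv_lt (PosNum e0)).
  apply: le_trans (_ : (eps m)%:E <= _)%E; last by rewrite lee_fin; exact: ltW.
  by rewrite leNgt; apply/negP => Em; apply: no; exists b, m.
have [phi iso phi_fg] := fg.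
have [F [j FV]] : exists F j, forall w, ball F j (evw f w) ->
    (mu01 (differ [:: b] 1%g (evw g w)) <= (eps m)%:E)%E.
  have [V' + V'P] := iso_nbhs iso phi_fg (ball1 [:: b] m).
  move=> /nbhs_L0P[F [e [e0 FV]]].
  have [j je] := filter_ex (near_infty_natSinv_lt (PosNum e0)).
  exists F, j => w wj; apply: ltW; apply: V'P; apply: FV; apply: lt_trans wj _.
  by rewrite lte_fin.
by exists (pickle ((b, m), (F, j))) => //; rewrite /N pickleK.
Qed.
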